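(* Let $(M, g(t))$, $t\in[0,T]$, be a solution to the Ricci flow $\frac{\partial g_{ij}}{\partial t} = -2R_{ij}$ on a manifold of dimension $n$, let $\tau = T-t$, let $c$ be a constant, and let $v$ satisfy $$\frac{\partial v}{\partial \tau} = \triangle v - |\nabla v|^2 - cR-\frac{n}{2\tau}.$$ Let $$P=\alpha \triangle v-\beta|\nabla v|^2+aR+b\frac{v}{\tau}+d\frac{n}{\tau},$$ where $\alpha$, $\beta$, $a$, $b$ and $d$ are constants, and let $\lambda$ also be a constant. Then $P$ satisfies the evolution equation \begin{align*} \frac{\partial P}{\partial \tau}=&\ \triangle P-2\nabla P \cdot \nabla v-(2\alpha-2\beta)\left|\nabla \nabla v+\frac{\alpha}{2\alpha-2\beta}R_{ij}-\frac{\lambda}{2\tau}g_{ij}\right|^2 -\frac{2\alpha-2\beta}{\alpha} \frac{\lambda}{\tau}P\\ &-2(\alpha-2\beta) R_{ij}v_iv_j+2(a+\beta c) \nabla R \cdot \nabla v +(2\alpha-2\beta)\frac{n \lambda^2}{4\tau^2}\\ &+\left(b-\frac{2\alpha-2\beta}{\alpha} \lambda \beta\right)\frac{|\nabla v|^2}{\tau}-(\alpha c+2a) \triangle R+\left(\frac{\alpha^2}{2\alpha-2\beta}-2a\right)|Rc|^2\\ &+\left(\frac{2\alpha-2\beta}{\alpha} \lambda-1\right)b\frac{v}{\tau^2}+\left(\frac{2\alpha-2\beta}{\alpha} \lambda -1\right)d\frac{n}{\tau^2}-\frac{bn}{2\tau^2}+\left(\frac{2\alpha-2\beta}{\alpha}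 a \lambda-\alpha\lambda -bc\right)\frac{R}{\tau}. \end{align*}
   Context: All geometric quantities are taken with respect to the evolving metric $g(t)$: $Rc=(R_{ij})$ is the Ricci curvature, $R$ the scalar curvature, $\nabla$ the Levi-Civita connection, $\nabla\nabla v$ the Hessian, $v_i=\nabla_i v$, $\triangle$ the Laplace-Beltrami operator (trace of the Hessian), $|\cdot|$ and $\cdot$ the norm and inner product of $g(t)$; repeated indices are contracted with $g(t)$. $\frac{\partial}{\partial\tau}=-\frac{\partial}{\partial t}$. *)

(* Defs.v *)
From HB Require Import structures.
From mathcomp Require Import all_boot all_order all_algebra.
From mathcomp Require Import all_classical all_reals all_analysis.

Set Implicit Arguments.
Unset Strict Implicit.
Unset Printing Implicit Defensive.

Import Order.TTheory GRing.Theory Num.Theory.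
Import numFieldNormedType.Exports.

Local Open Scope classical_set_scope.
Local Open Scope ring_scope.

(* MathComp-Analysis development.  Riemannian geometry is set up classically:
   a manifold is a space with an atlas, a tensor field is a family of component
   functions, one for each chart, subject to the transformation law, and the
   geometric quantities are given by their usual expressions in coordinates.
   By the transformation law, equations between scalars hold in every chart
   around a point as soon as they hold in one. *)

(** * Smooth functions *)

Section Smooth.
Context {R : realType} {V : normedModType R}.

(* f has continuous iterated directional derivatives up to order k on U;
   meaningful for U open *)
Fixpoint Ck (k : nat) (U : set V) (f : V -> R) : Prop :=
  (forall x, U x -> {for x, continuous f}) /\
  match k with
  | 0 => True
  | k'.+1 => forall w : V,
      (forall x, U x -> derivable f x w) /\ Ck k' U (fun x => 'D_w f x)
  end.

(* Smoothness on an arbitrary set, e.g. U x [0, T]: local extension to a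
   smooth function on an open set. *)
Definition smooth_on (A : set V) (f : V -> R) : Prop :=
  forall x, A x -> exists (U : set V) (h : V -> R),
    [/\ open U, U x, forall k, Ck k U h & forall y, A y -> U y -> f y = h y].

End Smooth.

(** * Time derivatives *)

(* The derivative at t of f along the interval I is l; one-sided when t is an
   endpoint of I. *)
Definition has_dt {R : realType} (I : set R) (f : R -> R) (t l : R) : Prop :=
  (f s - f t) / (s - t) @[s --> within (I `\ t) (nbhs t)] --> l.

(* d/dtau = - d/dt, as tau = T - t *)
Definition has_dtau {R : realType} (I : set R) (f : R -> R) (t l : R) : Prop :=
  has_dt I f t (- l).

(** * Riemannian geometry in a coordinate domain *)

Section Local.
Context {R : realType} {n : nat}.
Implicit Types (g : 'rV[R]_n -> 'M[R]_n) (f : 'rV[R]_n -> R) (x : 'rV[R]_n).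

Definition pd (i : 'I_n) f x : R := 'D_(delta_mx 0 i) f x.

(* Contractions at a point; G is the matrix (g_ij), so invmx G is (g^ij). *)
Definition trg (G A : 'M[R]_n) : R := \sum_i \sum_j invmx G i j * A i j.

Definition dotg (G : 'M[R]_n) (u w : 'rV[R]_n) : R :=
  \sum_i \sum_j invmx G i j * u 0 i * w 0 j.

Definition normsqg (G A : 'M[R]_n) : R :=
  \sum_i \sum_j \sum_k \sum_l
    invmx G i k * invmx G j l * A i j * A k l.

(* A_ij u_i w_j *)
Definition contrg (G A : 'M[R]_n) (u w : 'rV[R]_n) : R :=
  \sum_i \sum_j \sum_k \sum_l
    invmx G i k * invmx G j l * A i j * u 0 k * w 0 l.

(* christoffel g k i j is Gamma^k_ij *)
Definition christoffel g (k i j : 'I_n) x : R :=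
  2^-1 * \sum_l invmx (g x) k l *
    (pd i (fun y => g y j l) x + pd j (fun y => g y i l) x
     - pd l (fun y => g y i j) x).

(* riemann g i j k l is R_ijk^l, where
   [nabla_i, nabla_j] d_k = R_ijk^l d_l *)
Definition riemann g (i j k l : 'I_n) x : R :=
  pd i (christoffel g l j k) x - pd j (christoffel g l i k) x
  + \sum_p (christoffel g p j k x * christoffel g l i p x
            - christoffel g p i k x * christoffel g l j p x).

(* positive on round spheres *)
Definition ricci g x : 'M[R]_n :=
  \matrix_(j, k) \sum_i riemann g i j k i x.

Definition scal g x : R := trg (g x) (ricci g x).

(* the covector (nabla_i f) *)
Definition grad f x : 'rV[R]_n := \row_i pd i f x.

Definition hess g f x : 'M[R]_n :=
  \matrix_(i, j) (pd i (pd j f) x - \sum_k christoffel g k i j x * pd k f x).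

Definition laplacian g f x : R := trg (g x) (hess g f x).

Definition gradsq g f x : R := dotg (g x) (grad f x) (grad f x).

End Local.

(** * Manifolds *)

Record chart (R : realType) (n : nat) (M : topologicalType) := Chart {
  cdom : set M ;
  cmap : M -> 'rV[R]_n ;
  cinv : 'rV[R]_n -> M ;
  cdom_open : open cdom ;
  cimg_open : open (cmap @` cdom) ;
  cmapK : forall p, cdom p -> cinv (cmap p) = p ;
  cmap_cont : forall p, cdom p -> {for p, continuous cmap} ;
  cinv_cont : forall x, (cmap @` cdom) x -> {for x, continuous cinv}
}.

Definition cimg (R : realType) (n : nat) (M : topologicalType)
  (phi : chart R n M) : set 'rV[R]_n := cmap phi @` cdom phi.

Definition transition (R : realType) (n : nat) (M : topologicalType)
  (phi psi : chart R n M) (x : 'rV[R]_n) : 'rV[R]_n := cmap psi (cinv phi x).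

Record smooth_manifold (R : realType) (n : nat) := SmoothManifold {
  carrier :> topologicalType ;
  carrier_hausdorff : hausdorff_space carrier ;
  carrier_second_countable : @second_countable carrier ;
  atlas : set (chart R n carrier) ;
  atlas_cover : forall p : carrier, exists2 phi, atlas phi & cdom phi p ;
  atlas_smooth : forall phi psi, atlas phi -> atlas psi -> forall i : 'I_n,
    smooth_on (cmap phi @` (cdom phi `&` cdom psi))
              (fun x => transition phi psi x 0 i)
}.

Section Flow.
Context {R : realType} {n : nat} (M : smooth_manifold R n).

Definition jacob (phi psi : chart R n M) (x : 'rV[R]_n) : 'M[R]_n :=
  \matrix_(i, k) pd i (fun y => transition phi psi y 0 k) x.

(* A family g(t), t in I, of Riemannian metrics on M, smooth in space and time;
   mcomp phi t x is the matrix (g_ij(t)) at the point with coordinates x in the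
   chart phi. *)
Record metric_family (I : set R) := MetricFamily {
  mcomp :> chart R n M -> R -> 'rV[R]_n -> 'M[R]_n ;
  mcomp_smooth : forall phi, atlas phi -> forall i j,
    smooth_on (cimg phi `*` I)
      (fun z : 'rV[R]_n * R => mcomp phi z.2 z.1 i j) ;
  mcomp_sym : forall phi t x, atlas phi -> I t -> cimg phi x ->
    (mcomp phi t x)^T = mcomp phi t x ;
  mcomp_pos : forall phi t x, atlas phi -> I t -> cimg phi x ->
    forall w : 'rV[R]_n, w != 0 -> 0 < (w *m mcomp phi t x *m w^T) 0 0 ;
  mcomp_transf : forall phi psi t p, atlas phi -> atlas psi -> I t ->
    cdom phi p -> cdom psi p ->
    mcomp phi t (cmap phi p) =
      jacob phi psi (cmap phi p) *m mcomp psi t (cmap psi p)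
      *m (jacob phi psi (cmap phi p))^T
}.

(* d g_ij / dt = - 2 R_ij *)
Definition ricci_flow (I : set R) (g : metric_family I) : Prop :=
  forall phi t x, atlas phi -> I t -> cimg phi x -> forall i j,
    has_dt I (fun s => g phi s x i j) t (- 2 * ricci (g phi t) x i j).

Definition in_chart (phi : chart R n M) (f : M -> R) (x : 'rV[R]_n) : R :=
  f (cinv phi x).

Definition smooth_family (I : set R) (v : R -> M -> R) : Prop :=
  forall phi, atlas phi ->
    smooth_on (cimg phi `*` I)
      (fun z : 'rV[R]_n * R => in_chart phi (v z.2) z.1).

End Flow.

(* Main.v *)
Require Import Defs.
From HB Require Import structures.
From mathcomp Require Import all_boot all_order all_algebra.
From mathcomp Require Import all_classical all_reals all_analysis.
From mathcomp Require Import ring.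

Set Implicit Arguments.
Unset Strict Implicit.
Unset Printing Implicit Defensive.

Import Order.TTheory GRing.Theory Num.Theory.
Import numFieldNormedType.Exports.

Local Open Scope classical_set_scope.
Local Open Scope ring_scope.

(** The evolution equation is an identity between tensors at one point, so it
can be checked in a single chart.  There it is a consequence of four classical
facts about a metric with inverse E, Ricci tensor Rc and scalar curvature S
evolving by d/dt g = - 2 Rc:
- the Bochner formula
    Lap |grad f|^2 = 2 |Hess f|^2 + 2 <grad (Lap f), grad f> + 2 Rc(grad f, grad f);
- d/dt (Lap f) = Lap (d/dt f) + 2 <Rc, Hess f>;
- d/dt |grad f|^2 = 2 <grad (d/dt f), grad f> + 2 Rc(grad f, grad f);
- d/dt S = Lap S + 2 |Rc|^2.
Combined linearly according to the definition of P, with the equation of v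
substituted for d/dt v, they express d/dt P through Lap P, grad P and
lower-order terms; the term - 2 alpha <Rc, Hess v> left over and the terms in
lambda are what completing the square produces, which is elementary algebra.

All of these facts are formal: they use only that the partial derivatives and
the time derivative are commuting derivations and that the metric is symmetric
and invertible.  The first part below therefore works over an arbitrary
commutative ring with commuting derivations.  A tensor with two indices is a
matrix, the Christoffel symbols are a family Gamma i of matrices, and the
curvature is the family of matrices curv i j; so the covariant calculus reduces
to products, transposes and traces of matrices.  The only symmetries of the
curvature that are needed are its skewness in the last two indices
([curv_skew]) and the second Bianchi identity ([bianchi2]); the contraction of
the latter ([contracted_bianchi]) makes the trace of the variation of the
Christoffel symbols vanish ([tr_h]), which gives the second and the fourth fact.

The second part provides such a ring: the functions on space-time that are
smooth on (chart domain) x [0, T[ in the sense of local smooth extensions.  The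
derivations commute by the symmetry of second derivatives ([schwarz]), applied
to an extension, so that the one-sided time derivative at 0 causes no
trouble.  Derivatives are set to 0, and the metric to the identity, off the
domain: then all identities hold everywhere, as equalities in the ring.

The last part evaluates the abstract tensors at a point, where they become the
coordinate expressions, and completes the square ([local_evolution]). *)

(** * Tensor calculus over a ring with commuting derivations *)
Section Calculus.
Variables (A : comNzRingType) (n : nat).

Definition leibniz (d : A -> A) := forall x y, d (x * y) = d x * y + x * d y.

Lemma map_mx_leibniz (d : {additive A -> A}) : leibniz d ->
  forall m p q (X : 'M[A]_(m, p)) (Y : 'M[A]_(p, q)),
  map_mx d (X *m Y) = map_mx d X *m Y + X *m map_mx d Y.
Proof.
move=> dM m p q X Y; apply/matrixP => i j; rewrite !mxE raddf_sum -big_split.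
by apply: eq_bigr => k _; rewrite dM !mxE.
Qed.

Lemma leibniz1 (d : {additive A -> A}) : leibniz d -> d 1 = 0.
Proof.
move=> dM; have /eqP := dM 1 1.
by rewrite !mulr1 mul1r -subr_eq subrr eq_sym => /eqP.
Qed.

Lemma map_mx_leibniz1 (d : {additive A -> A}) : leibniz d ->
  map_mx d (1%:M : 'M[A]_n) = 0.
Proof.
move=> dM; apply/matrixP => i j; rewrite !mxE.
by case: (i == j); rewrite ?leibniz1 // raddf0.
Qed.

Lemma D_trace (d : {additive A -> A}) (X : 'M[A]_n) :
  d (\tr X) = \tr (map_mx d X).
Proof. by rewrite raddf_sum; apply: eq_bigr => i _; rewrite mxE. Qed.

Lemma mxtrace_opp (X : 'M[A]_n) : \tr (- X) = - \tr X.
Proof. exact: raddfN. Qed.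

Lemma mxtraceE m (X : 'M[A]_(n, m)) (Y : 'M[A]_(m, n)) :
  \tr (X *m Y) = \sum_i \sum_j X i j * Y j i.
Proof. by apply: eq_bigr => i _; rewrite mxE. Qed.

Lemma addmxE m p (X Y : 'M[A]_(m, p)) i j : (X + Y) i j = X i j + Y i j.
Proof. by rewrite mxE. Qed.
Lemma oppmxE m p (X : 'M[A]_(m, p)) i j : (- X) i j = - X i j.
Proof. by rewrite mxE. Qed.

Lemma zeromxE m p i j : (0 : 'M[A]_(m, p)) i j = 0.
Proof. by rewrite mxE. Qed.

(* Equalities of signed sums of matrices that need only the commutativity of
addition: the products become atoms, and the entries are compared in the
commutative ring of coefficients; [mx_abel_using] compares the difference of
the two sides with that of the equation at the head of the goal. *)
Ltac mx_atoms := repeat match goal with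
  | |- context [@mulmx ?R ?m ?p ?q ?X ?Y] =>
    let x := fresh in set x := (@mulmx R m p q X Y); clearbody x
  | |- context [@map_mx ?R ?S ?f ?m ?p ?X] =>
    let x := fresh in set x := (@map_mx R S f m p X); clearbody x
  | |- context [@bigop.body ?R ?I ?x0 ?r ?F] =>
    let x := fresh in set x := (@bigop.body R I x0 r F); clearbody x
  end.
Ltac mx_abel := mx_atoms; apply/matrixP => ? ?; rewrite !(addmxE, oppmxE, zeromxE); ring.
Ltac mx_abel_using := let e := fresh in move=> e;
  apply/matrixP => k l; move/matrixP/(_ k l): e; rewrite !(addmxE, oppmxE, zeromxE) => /eqP;
  rewrite -subr_eq0 => /eqP e; apply/eqP; rewrite -subr_eq0; apply/eqP; rewrite -[RHS]e; ring.

(** [D i] is the partial derivative along the i-th coordinate, [g] the matrix of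
the metric, [E] its inverse, and [half] the scalar 1/2. *)
Variables (D : 'I_n -> {additive A -> A}) (g E : 'M[A]_n) (half : A).
Hypothesis DM : forall i, leibniz (D i).
Hypothesis DC : forall i j x, D i (D j x) = D j (D i x).
Hypothesis half2 : half + half = 1.
Hypothesis gE : g *m E = 1%:M.
Hypothesis gT : g^T = g.

(** The matrix with entries Gamma^k_ij in row j and column k: it sends the
column of coordinate fields to its covariant derivative along the i-th one. *)
Definition Gamma (i : 'I_n) : 'M[A]_n := \matrix_(j, k)
  (half * \sum_l E k l * (D i (g j l) + D j (g i l) - D l (g i j))).

(** The curvature of the connection matrices, with R_ijk^l in row k and column
l.  As the matrices act on the frame, the commutator has the order opposite to
the one of the composition of covariant derivatives. *)
Definition curv (i j : 'I_n) : 'M[A]_n :=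
  map_mx (D i) (Gamma j) - map_mx (D j) (Gamma i) + (Gamma j *m Gamma i - Gamma i *m Gamma j).

Definition Ricci : 'M[A]_n := \matrix_(j, k) \sum_i curv i j k i.

Definition gtrace (T : 'M[A]_n) : A := \tr (E *m T).

Definition Scal : A := gtrace Ricci.

Definition gradv (f : A) : 'cV[A]_n := \col_i D i f.

(** [cov1], [cov2] and [covd] are covariant derivatives of covectors and of
covariant 2-tensors; the row index of [covd] is the direction of derivation. *)
Definition cov1 i (V : 'cV[A]_n) : 'cV[A]_n := map_mx (D i) V - Gamma i *m V.

Definition cov2 i (T : 'M[A]_n) : 'M[A]_n :=
  map_mx (D i) T - Gamma i *m T - T *m (Gamma i)^T.

Definition covd (V : 'cV[A]_n) : 'M[A]_n := \matrix_(i, j) cov1 i V j 0.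

Definition Hess (f : A) := covd (gradv f).
Definition Lap (f : A) := gtrace (Hess f).
Definition ginner (V W : 'cV[A]_n) : A := gtrace (V *m W^T).

Lemma Eg : E *m g = 1%:M. Proof. exact: mulmx1C gE. Qed.

Lemma ET : E^T = E.
Proof.
by rewrite -[LHS]mulmx1 -gE mulmxA -{1}gT -trmx_mul gE trmx1 mul1mx.
Qed.

Lemma Esym i j : E i j = E j i. Proof. by rewrite -{1}ET mxE. Qed.
Lemma gsym i j : g i j = g j i. Proof. by rewrite -{1}gT mxE. Qed.

Lemma half_dbl x : half * x + half * x = x.
Proof. by rewrite -mulrDl half2 mul1r. Qed.

Lemma addrr_inj (x y : A) : x + x = y + y -> x = y.
Proof. by move=> e; rewrite -(half_dbl x) -(half_dbl y) -!mulrDr e. Qed.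

Lemma half_const (d : {additive A -> A}) : leibniz d -> d half = 0.
Proof.
move=> dM; apply: addrr_inj; rewrite -raddfD half2 leibniz1 // addr0 //.
Qed.

Lemma Gamma_sym i j k : Gamma i j k = Gamma j i k.
Proof.
rewrite !mxE; congr (_ * _); apply: eq_bigr => l _.
by rewrite [g j i]gsym [D i _ + _]addrC.
Qed.

Lemma Gamma_lower i : Gamma i *m g =
  \matrix_(j, l) (half * (D i (g j l) + D j (g i l) - D l (g i j))).
Proof.
set N := (RHS); have -> : Gamma i = N *m E.
  apply/matrixP => j k; rewrite !mxE mulr_sumr; apply: eq_bigr => l _.
  by rewrite !mxE Esym; ring.
by rewrite -mulmxA Eg mulmx1.
Qed.

Lemma metric_compat i : map_mx (D i) g = Gamma i *m g + g *m (Gamma i)^T.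
Proof.
have -> : g *m (Gamma i)^T = (Gamma i *m g)^T by rewrite trmx_mul gT.
rewrite Gamma_lower; apply/matrixP => j l; rewrite !mxE.
by rewrite [g l j]gsym -mulrDr -[LHS]half_dbl -mulrDr; congr (_ * _); ring.
Qed.

Lemma D_inv (d : {additive A -> A}) : leibniz d ->
  map_mx d E = - (E *m map_mx d g *m E).
Proof.
move=> dM; have /(congr1 (mulmx E)) : map_mx d (g *m E) = 0.
  by rewrite gE map_mx_leibniz1.
rewrite map_mx_leibniz // mulmx0 mulmxDr 2!mulmxA Eg mul1mx => /eqP.
by rewrite addrC addr_eq0 => /eqP.
Qed.

(** Equivalent to the parallelism of the inverse metric.  It is used in this form
to commute derivatives with contractions. *)
Lemma metric_compatV i : map_mx (D i) E = - (E *m Gamma i) - (Gamma i)^T *m E.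
Proof.
rewrite D_inv // metric_compat mulmxDr mulmxDl -!mulmxA gE mulmx1.
by rewrite (mulmxA E g) Eg mul1mx opprD.
Qed.

(** A contraction with the metric commutes with covariant derivatives, since the
connection terms of the tensor are those of the derivative of [E], up to
cyclicity of the trace. *)
Lemma D_gtrace i T : D i (gtrace T) = gtrace (cov2 i T).
Proof.
rewrite /gtrace D_trace map_mx_leibniz // metric_compatV /cov2.
rewrite !(mulmxDl, mulmxDr, mulNmx, mulmxN, mxtraceD) -!mulmxA !mxtrace_opp.
rewrite [\tr ((Gamma i)^T *m _)]mxtrace_mulC -!mulmxA; ring.
Qed.

Lemma curv_antisym i j : curv i j = - curv j i.
Proof. by rewrite /curv opprD !opprB. Qed.

(** Skewness of R_ijkl in k and l, with one index raised: the second derivatives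
of g commute, and by metric compatibility their commutator is
curv i j *m g plus its transpose. *)
Lemma curv_skew i j : E *m curv i j = - ((curv i j)^T *m E).
Proof.
have H : curv i j *m g + g *m (curv i j)^T = 0.
  have dd k l : map_mx (D k) (map_mx (D l) g) =
      map_mx (D k) (Gamma l) *m g + Gamma l *m (Gamma k *m g) + Gamma l *m (g *m (Gamma k)^T)
      + (Gamma k *m (g *m (Gamma l)^T) + g *m ((Gamma k)^T *m (Gamma l)^T))
      + g *m map_mx (D k) (Gamma l)^T.
    rewrite (metric_compat l) map_mxD !map_mx_leibniz // metric_compat.
    by rewrite !mulmxDr !mulmxDl -!mulmxA !addrA.
  have e : map_mx (D i) (map_mx (D j) g) = map_mx (D j) (map_mx (D i) g).
    by apply/matrixP => k l; rewrite !mxE DC.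
  rewrite !dd in e; rewrite /curv !(raddfD, raddfN) /= !trmx_mul !map_trmx.
  move: e; rewrite !(mulmxDl, mulmxDr, mulNmx, mulmxN) -!mulmxA; mx_abel_using.
move/eqP: H; rewrite addr_eq0 => /eqP H.
by rewrite -[LHS]mulmx1 -gE mulmxA -(mulmxA E) H mulmxN mulNmx mulmxA Eg mul1mx.
Qed.

Lemma curvE i j : curv i j =
  map_mx (D i) (Gamma j) - map_mx (D j) (Gamma i) + (Gamma j *m Gamma i - Gamma i *m Gamma j).
Proof. by []. Qed.

Lemma curv_entry i j k l : curv i j k l =
  D i (Gamma j k l) - D j (Gamma i k l)
  + \sum_p (Gamma j k p * Gamma i p l - Gamma i k p * Gamma j p l).
Proof.
by rewrite /curv !(addmxE, oppmxE) sumrB; congr (_ - _ + (_ - _)); rewrite [LHS]mxE.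
Qed.

Lemma Gamma_entry i j k : Gamma i j k =
  half * \sum_l E k l * (D i (g j l) + D j (g i l) - D l (g i j)).
Proof. by rewrite mxE. Qed.

Lemma Hess_entry f i j : Hess f i j = D i (D j f) - \sum_k Gamma i j k * D k f.
Proof.
rewrite [LHS]mxE /cov1 addmxE oppmxE; congr (_ - _); first by rewrite !mxE.
by rewrite [LHS]mxE; apply: eq_bigr => k _; rewrite [gradv _ _ _]mxE.
Qed.

(* From here on these enter only through the equations above. *)
Opaque Gamma curv map_mx mulmx.

(** The full covariant derivative of the curvature, including the connection
terms of its first two indices. *)
Definition covcurv (k i j : 'I_n) : 'M[A]_n :=
  map_mx (D k) (curv i j) - Gamma k *m curv i j + curv i j *m Gamma k
  - \sum_p Gamma k i p *: curv p j - \sum_p Gamma k j p *: curv i p.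

Lemma covcurv_antisym k i j : covcurv k i j = - covcurv k j i.
Proof.
have e m (c : 'I_n -> A) : \sum_p c p *: curv m p = - \sum_p c p *: curv p m.
  by rewrite -sumrN; apply: eq_bigr => p _; rewrite curv_antisym scalerN.
rewrite /covcurv (curv_antisym i j) (e j (Gamma k i)) (e i (Gamma k j)) map_mxN mulmxN mulNmx.
mx_abel.
Qed.

(** The connection terms of the first two indices cancel in the cyclic sum
because Gamma is symmetric in its lower indices and the curvature is
antisymmetric.  What is left is the Jacobi identity for the operators
D i - Gamma i. *)
Lemma bianchi2 k i j : covcurv k i j + covcurv i j k + covcurv j k i = 0.
Proof.
have dd a b c : map_mx (D a) (map_mx (D b) (Gamma c)) = map_mx (D b) (map_mx (D a) (Gamma c)).
  by apply/matrixP => x y; rewrite ![_ (map_mx _ _) _ _]mxE !mxE DC.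
have e a b c : \sum_p Gamma a b p *: curv p c = - \sum_p Gamma b a p *: curv c p.
  by rewrite -sumrN; apply: eq_bigr => p _; rewrite curv_antisym scalerN Gamma_sym.
rewrite /covcurv (e k i) (e i j) (e j k) !curvE.
rewrite !(map_mxD, map_mxN, map_mxB) !map_mx_leibniz //.
rewrite (dd k i) (dd k j) (dd i j).
rewrite !(mulmxDl, mulmxDr, mulNmx, mulmxN) -!mulmxA.
mx_abel.
Qed.

(** Contracting an upper with a lower index commutes with covariant derivatives:
the two connection terms created by the contracted indices cancel. *)
Lemma covcurv_Ricci k j l : \sum_i covcurv k i j l i = cov2 k Ricci j l.
Proof.
have sE (c : 'I_n -> A) (X : 'I_n -> 'M[A]_n) i :
    (\sum_p c p *: X p) l i = \sum_p c p * X p l i.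
  by rewrite summxE; apply: eq_bigr => p _; rewrite mxE.
under eq_bigr do rewrite /covcurv !(addmxE, oppmxE) !sE.
rewrite !(big_split, sumrN) /=.
have -> : \sum_i (curv i j *m Gamma k) l i = \sum_i \sum_p Gamma k i p * curv p j l i.
  under eq_bigr do rewrite mxE.
  rewrite exchange_big /=; apply: eq_bigr => p _; apply: eq_bigr => q _.
  by rewrite mulrC.
rewrite addrK /cov2 !(addmxE, oppmxE) -addrA [- \sum_(i < n) _ - _]addrC addrA.
congr (_ - _ - _).
- by rewrite !mxE raddf_sum; apply: eq_bigr => i _; rewrite mxE.
- rewrite exchange_big /= [RHS]mxE; apply: eq_bigr => p _.
  by rewrite -mulr_sumr [Ricci _ _]mxE.
rewrite [RHS]mxE; under eq_bigr do rewrite mxE.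
rewrite exchange_big; apply: eq_bigr => p _ /=.
by rewrite -mulr_sumr !mxE mulrC.
Qed.

(** The other trace of the curvature is again Ricci, by skewness. *)
Lemma trE_curv k i : \sum_j (E *m curv j k) j i = - (Ricci *m E) k i.
Proof.
under eq_bigr do rewrite curv_skew oppmxE mxE.
rewrite sumrN exchange_big mxE; congr (- _); apply: eq_bigr => p _.
rewrite !mxE mulr_suml; apply: eq_bigr => j _.
by rewrite mxE (curv_antisym j) curv_antisym opprK.
Qed.

Lemma gtraceE T : gtrace T = \sum_i \sum_j E i j * T i j.
Proof.
rewrite /gtrace mxtraceE exchange_big; apply: eq_bigr => i _; apply: eq_bigr => j _.
by rewrite Esym.
Qed.

(** The divergence, in the second index. *)
Definition divT (T : 'M[A]_n) (k : 'I_n) : A := \sum_i (cov2 i T *m E) k i.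

(** The derivative of the contraction [trE_curv]: in the middle term of the
second Bianchi identity the divergence and the metric contraction act at once. *)
Lemma trE_covcurv k : \sum_i \sum_j (E *m covcurv i j k) j i = - divT Ricci k.
Proof.
rewrite /divT -sumrN; apply: eq_bigr => i _.
set Y := Ricci *m E.
have YE a b : \sum_j (E *m curv j a) j b = - Y a b by exact: trE_curv.
have tE (c : 'I_n -> A) (X : 'I_n -> 'M[A]_n) a b :
    (E *m \sum_p c p *: X p) a b = \sum_p c p * (E *m X p) a b.
  rewrite mulmx_sumr summxE; apply: eq_bigr => p _.
  by rewrite -scalemxAr mxE.
have e j : E *m covcurv i j k = map_mx (D i) (E *m curv j k)
   + (Gamma i)^T *m (E *m curv j k) + (E *m curv j k) *m Gamma i
   - E *m (\sum_p Gamma i j p *: curv p k) - E *m (\sum_p Gamma i k p *: curv j p).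
  rewrite /covcurv map_mx_leibniz // metric_compatV !(mulmxDr, mulmxDl, mulmxN, mulNmx).
  rewrite -!mulmxA; mx_abel.
under eq_bigr do rewrite e !(addmxE, oppmxE) !tE.
rewrite !(big_split, sumrN) /=.
have -> : \sum_j ((Gamma i)^T *m (E *m curv j k)) j i =
    \sum_j \sum_p Gamma i j p * (E *m curv p k) j i.
  rewrite exchange_big /=; apply: eq_bigr => p _.
  by rewrite mxE; apply: eq_bigr => q _; rewrite [_^T _ _]mxE.
have -> : \sum_j (map_mx (D i) (E *m curv j k)) j i = - (map_mx (D i) Y) k i.
  under eq_bigr do rewrite mxE.
  rewrite -(raddf_sum (D i)) YE raddfN; congr (- _); by rewrite [(map_mx _ _) _ _]mxE.
have -> : \sum_j (E *m curv j k *m Gamma i) j i = - (Y *m Gamma i) k i.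
  under eq_bigr do rewrite mxE.
  rewrite exchange_big mxE -sumrN; apply: eq_bigr => p _.
  by rewrite -mulr_suml YE mulNr.
have -> : \sum_j \sum_p Gamma i k p * (E *m curv j p) j i = - (Gamma i *m Y) k i.
  rewrite exchange_big [in RHS]mxE -sumrN; apply: eq_bigr => p _.
  by rewrite -mulr_sumr YE mulrN.
have -> : cov2 i Ricci *m E = map_mx (D i) Y + Y *m Gamma i - Gamma i *m Y.
  rewrite /cov2 /Y map_mx_leibniz // metric_compatV.
  rewrite !(mulmxDr, mulmxDl, mulmxN, mulNmx) -!mulmxA; mx_abel.
rewrite !(addmxE, oppmxE); ring.
Qed.

(** The two contractions of the second Bianchi identity give the derivative of
the scalar curvature once and the divergence of Ricci twice. *)
Lemma contracted_bianchi k : D k Scal = divT Ricci k + divT Ricci k.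
Proof.
rewrite /Scal D_gtrace.
have trE_K (F : 'I_n -> 'I_n -> 'M[A]_n) (T : 'I_n -> 'I_n -> A) :
    (forall j l, \sum_i F j i l i = T j l) ->
    \sum_i \sum_j (E *m F j i) j i = \sum_j \sum_l E j l * T j l.
  move=> H; rewrite exchange_big; apply: eq_bigr => j _ /=.
  under eq_bigr do rewrite mxE.
  by rewrite exchange_big; apply: eq_bigr => l _; rewrite -mulr_sumr H.
have e1 : \sum_i \sum_j (E *m covcurv k i j) j i = gtrace (cov2 k Ricci).
  rewrite gtraceE; apply: (@trE_K (fun j i => covcurv k i j) (fun j l => cov2 k Ricci j l)).
  exact: covcurv_Ricci.
have e3 : \sum_i \sum_j (E *m covcurv j k i) j i = - divT Ricci k.
  rewrite (@trE_K (fun j i => covcurv j k i) (fun j l => - cov2 j Ricci k l)); last first.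
    move=> j l; rewrite -covcurv_Ricci -sumrN; apply: eq_bigr => i _.
    by rewrite covcurv_antisym oppmxE.
  rewrite /divT -sumrN; apply: eq_bigr => j _; rewrite mxE -sumrN.
  by apply: eq_bigr => l _; rewrite mulrN mulrC [E l j]Esym.
have : gtrace (cov2 k Ricci) - divT Ricci k - divT Ricci k = 0.
  rewrite -{1}trE_covcurv -e1 -e3 -!big_split big1 // => i _.
  rewrite -!big_split big1 // => j _.
  by rewrite /= -!addmxE -!mulmxDr bianchi2 mulmx0 mxE.
move=> /eqP.
by rewrite -addrA -opprD subr_eq0 => /eqP.
Qed.

Lemma cov2_covd V j k i : cov2 j (covd V) k i =
  cov1 j (cov1 k V) i 0 - \sum_p Gamma j k p * covd V p i.
Proof.
rewrite /cov2 !(addmxE, oppmxE) addrAC /cov1.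
congr (_ - _ - _).
- by rewrite [LHS]mxE [covd _ _ _]mxE [RHS]mxE.
- rewrite [LHS]mxE [RHS]mxE; apply: eq_bigr => p _.
  by rewrite [covd _ _ _]mxE [_^T _ _]mxE mulrC.
by rewrite [LHS]mxE.
Qed.

(** The commutator of covariant derivatives of a covector, up to the connection
terms of the direction of derivation, which are symmetric. *)
Lemma cov1_comm V j k :
  cov1 j (cov1 k V) - cov1 k (cov1 j V) = - (curv j k *m V).
Proof.
have dd : map_mx (D j) (map_mx (D k) V) = map_mx (D k) (map_mx (D j) V).
  by apply/matrixP => x y; rewrite !mxE DC.
rewrite /cov1 curvE !(map_mxD, map_mxN, map_mxB) !map_mx_leibniz // dd.
rewrite !(mulmxDl, mulmxDr, mulNmx, mulmxN) -!mulmxA.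
mx_abel.
Qed.

Lemma ricci_identity V j k i :
  cov2 j (covd V) k i = cov2 k (covd V) j i - (curv j k *m V) i 0.
Proof.
have : cov1 j (cov1 k V) i 0 - cov1 k (cov1 j V) i 0 = - (curv j k *m V) i 0.
  by rewrite -!oppmxE -addmxE cov1_comm.
rewrite !cov2_covd => /eqP; rewrite subr_eq => /eqP ->.
have -> : \sum_p Gamma j k p * covd V p i = \sum_p Gamma k j p * covd V p i.
  by apply: eq_bigr => p _; rewrite Gamma_sym.
by rewrite -addrA addrC.
Qed.

Lemma ginner_sym V W : ginner V W = ginner W V.
Proof.
rewrite /ginner /gtrace -mxtrace_tr trmx_mul trmx_mul trmxK ET mxtrace_mulC //.
Qed.

Lemma ginnerE V W : ginner V W = \sum_k V k 0 * (E *m W) k 0.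
Proof.
rewrite ginner_sym /ginner /gtrace mulmxA mxtraceE; apply: eq_bigr => k _.
by rewrite big_ord1 [V^T _ _]mxE mulrC.
Qed.

Lemma D_ginner i V W : D i (ginner V W) = ginner (cov1 i V) W + ginner V (cov1 i W).
Proof.
rewrite /ginner D_gtrace /gtrace -mxtraceD -mulmxDr; congr (\tr (_ *m _)).
rewrite /cov2 /cov1 map_mx_leibniz // -!map_trmx.
rewrite !(raddfD, raddfN) /= trmx_mul !(mulmxDl, mulmxDr, mulmxN, mulNmx).
rewrite !mulmxA; mx_abel.
Qed.

Lemma gradv_ginner V i : gradv (ginner V V) i 0 = (covd V *m E *m V *+ 2) i 0.
Proof.
rewrite mxE D_ginner [ginner V _]ginner_sym ginnerE -mulmxA mulr2n addmxE.
by congr (_ + _); rewrite mxE; apply: eq_bigr => k _; rewrite [covd _ _ _]mxE.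
Qed.

Lemma Hess_sym f i j : Hess f i j = Hess f j i.
Proof.
rewrite /Hess [LHS]mxE [RHS]mxE /cov1 !(addmxE, oppmxE).
congr (_ - _); first by rewrite !mxE DC.
by rewrite [LHS]mxE [RHS]mxE; apply: eq_bigr => k _; rewrite Gamma_sym.
Qed.

Lemma cov1_mul j (T : 'M[A]_n) V :
  cov1 j (T *m E *m V) = cov2 j T *m E *m V + T *m E *m cov1 j V.
Proof.
rewrite /cov1 /cov2 !map_mx_leibniz // metric_compatV.
rewrite !(mulmxDl, mulmxDr, mulNmx, mulmxN) -!mulmxA; mx_abel.
Qed.

Lemma cov2_tr i T : (cov2 i T)^T = cov2 i T^T.
Proof.
rewrite /cov2 -map_trmx !(raddfD, raddfN) /= !trmx_mul trmxK; mx_abel.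
Qed.

Lemma cov2_sym i T j k : T^T = T -> cov2 i T j k = cov2 i T k j.
Proof. by move=> eT; rewrite -{1}eT -cov2_tr [LHS]mxE. Qed.

Lemma Hess_tr f : (Hess f)^T = Hess f.
Proof. by apply/matrixP => i j; rewrite [LHS]mxE Hess_sym. Qed.

(** Exchanging the outer and the middle derivative in the third covariant
derivative of f costs one curvature term, whose trace is a Ricci term. *)
Lemma div_Hess f k : \sum_i \sum_j E i j * cov2 i (Hess f) j k =
  D k (Lap f) + (Ricci *m E *m gradv f) k 0.
Proof.
have symc i j : E i j * cov2 i (Hess f) j k =
    E i j * cov2 k (Hess f) i j - E i j * (curv i k *m gradv f) j 0.
  by rewrite (cov2_sym _ _ _ (Hess_tr f)) -mulrBr -ricci_identity.
under eq_bigr do (under eq_bigr do rewrite symc; rewrite big_split /= sumrN).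
rewrite big_split /= sumrN -gtraceE /Lap D_gtrace; congr (_ + _).
have e i : \sum_j E i j * (curv i k *m gradv f) j 0 =
    \sum_p (E *m curv i k) i p * gradv f p 0.
  transitivity ((E *m (curv i k *m gradv f)) i 0); first by rewrite [RHS]mxE.
  by rewrite mulmxA [LHS]mxE.
under eq_bigr do rewrite e.
rewrite exchange_big [RHS]mxE -sumrN; apply: eq_bigr => p _ /=.
by rewrite -mulr_suml trE_curv mulNr opprK.
Qed.

(** The squared norm |T|^2 for the metric. *)
Definition gnormsq (T : 'M[A]_n) := \tr (E *m T *m E *m T^T).
(** T(V, V), with the indices of V raised. *)
Definition gquad (T : 'M[A]_n) (V : 'cV[A]_n) :=
  \sum_k (T *m E *m V) k 0 * (E *m V) k 0.

(** The gradient of |grad f|^2 is twice the Hessian applied to grad f.  Deriving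
once more and tracing gives |Hess f|^2 and the divergence of the Hessian,
which [div_Hess] computes. *)
Lemma bochner f : Lap (ginner (gradv f) (gradv f)) =
  (gnormsq (Hess f) + ginner (gradv (Lap f)) (gradv f) + gquad Ricci (gradv f)) *+ 2.
Proof.
set V := gradv f; set w := ginner V V.
have dw : gradv w = covd V *m E *m V *+ 2.
  by apply/matrixP => i j; rewrite ord1 gradv_ginner.
have cw i j : covd (gradv w) i j =
    (cov2 i (Hess f) *m (E *m V)) j 0 *+ 2 + (Hess f *m E *m cov1 i V) j 0 *+ 2.
  rewrite mxE dw.
  have -> : cov1 i (covd V *m E *m V *+ 2) = cov1 i (covd V *m E *m V) *+ 2.
    rewrite /cov1 !mulr2n mulmxDr map_mxD; mx_abel.
  by rewrite cov1_mul mulr2n !addmxE -mulmxA; ring.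
rewrite /Lap /Hess gtraceE.
under eq_bigr do
  (under eq_bigr do rewrite cw mulrDr !mulrnAr; rewrite big_split /= !sumrMnl).
rewrite big_split /= !sumrMnl -mulrnDl; congr (_ *+ 2); rewrite addrC -addrA.
congr (_ + _).
  rewrite /gnormsq mxtraceE; apply: eq_bigr => i _.
  transitivity ((E *m (Hess f *m E *m cov1 i V)) i 0); first by rewrite [RHS]mxE.
  rewrite !mulmxA [LHS]mxE; apply: eq_bigr => j _.
  by rewrite [(_^T) _ _]mxE [Hess _ _ _]mxE.
transitivity (\sum_k (\sum_i \sum_j E i j * cov2 i (Hess f) j k) * (E *m V) k 0).
  under [RHS]eq_bigr do rewrite mulr_suml.
  rewrite [RHS]exchange_big; apply: eq_bigr => i _ /=.
  under [RHS]eq_bigr do rewrite mulr_suml.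
  rewrite [RHS]exchange_big; apply: eq_bigr => j _ /=.
  by rewrite mxE mulr_sumr; apply: eq_bigr => k _; rewrite mulrA.
rewrite ginnerE /gquad -big_split; apply: eq_bigr => k _ /=.
by rewrite div_Hess [gradv _ _ _]mxE -mulrDl.
Qed.

(** From here on the metric evolves by the Ricci flow along the derivation
[dt]. *)
Variable dt : {additive A -> A}.
Hypothesis dtM : leibniz dt.
Hypothesis dtD : forall i x, dt (D i x) = D i (dt x).
Hypothesis dtg : map_mx dt g = - (Ricci + Ricci).

Lemma dtE : map_mx dt E = E *m Ricci *m E + E *m Ricci *m E.
Proof. by rewrite D_inv // dtg mulmxN mulNmx opprK mulmxDr mulmxDl. Qed.

Lemma dt_g j l : dt (g j l) = - (Ricci j l + Ricci j l).
Proof. by have /matrixP/(_ j l) := dtg; rewrite mxE oppmxE addmxE. Qed.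

Lemma Ricci_sym j k : Ricci j k = Ricci k j.
Proof.
apply: addrr_inj; apply: oppr_inj; by rewrite -!dt_g gsym.
Qed.

Lemma Ricci_tr : Ricci^T = Ricci.
Proof. by apply/matrixP => j k; rewrite [LHS]mxE Ricci_sym. Qed.

Local Notation h i := (map_mx dt (Gamma i)).

(** The variation of the connection is tensorial: lowering the upper index with
the metric turns the derivatives of - 2 Rc into covariant ones. *)
Lemma h_lower i j l : (h i *m g) j l =
  - (cov2 i Ricci j l + cov2 j Ricci i l - cov2 l Ricci i j).
Proof.
have eh : h i *m g = map_mx dt (Gamma i *m g) + Gamma i *m (Ricci + Ricci).
  by rewrite map_mx_leibniz // dtg mulmxN subrK.
have e2 a b c : (Ricci *m (Gamma a)^T) b c = (Gamma a *m Ricci) c b.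
  by rewrite -[Ricci *m _]trmxK trmx_mul trmxK Ricci_tr [LHS]mxE.
have e3 a b c : (Gamma a *m Ricci) b c = (Gamma b *m Ricci) a c.
  by rewrite [LHS]mxE [RHS]mxE; apply: eq_bigr => p _; rewrite Gamma_sym.
have e a b c : cov2 a Ricci b c =
    D a (Ricci b c) - (Gamma a *m Ricci) b c - (Gamma a *m Ricci) c b.
  by rewrite /cov2 !(addmxE, oppmxE) e2 [(map_mx _ _) _ _]mxE.
rewrite !e eh mulmxDr !addmxE Gamma_lower [(map_mx _ _) _ _]mxE [(matrix_of_fun _ _) _ _]mxE.
rewrite dtM half_const // mul0r add0r !(raddfD dt) (raddfN dt) /= !dtD !dt_g.
rewrite !(raddfN (D _)) !(raddfD (D _)) /= (e3 j i) (e3 l i) (e3 l j).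
have e4 a b c : half * (- (a + a) - (b + b) - - (c + c)) = - (a + b - c).
  by rewrite -[RHS]half_dbl; ring.
rewrite e4; ring.
Qed.

Lemma hE i j k : h i j k = - \sum_l
  (cov2 i Ricci j l + cov2 j Ricci i l - cov2 l Ricci i j) * E l k.
Proof.
rewrite -[h i]mulmx1 -gE mulmxA [LHS]mxE -sumrN; apply: eq_bigr => l _.
by rewrite h_lower mulNr.
Qed.

(** The metric trace of the variation of the connection is the contracted Bianchi
identity.  Hence only the variation of the inverse metric contributes to the
evolution of the Laplacian. *)
Lemma tr_h k : \sum_i \sum_j E i j * h i j k = 0.
Proof.
transitivity (- \sum_l (divT Ricci l + divT Ricci l - D l Scal) * E l k); last first.
  by rewrite big1 ?oppr0 // => l _; rewrite contracted_bianchi subrr mul0r.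
have exch3 (F : 'I_n -> 'I_n -> 'I_n -> A) :
    \sum_i \sum_j \sum_l F i j l = \sum_l \sum_i \sum_j F i j l.
  rewrite [RHS]exchange_big; apply: eq_bigr => i _; exact: exchange_big.
under eq_bigr do (under eq_bigr do rewrite hE mulrN mulr_sumr; rewrite sumrN).
rewrite sumrN exch3; congr (- _); apply: eq_bigr => l _ /=.
rewrite /Scal D_gtrace gtraceE /divT.
have -> : \sum_i (cov2 i Ricci *m E) l i = \sum_i \sum_j E i j * cov2 i Ricci j l.
  apply: eq_bigr => i _; rewrite mxE; apply: eq_bigr => j _.
  by rewrite mulrC Esym (cov2_sym _ _ _ Ricci_tr).
set X := (X in X + X); have eX : X = \sum_i \sum_j E i j * cov2 j Ricci i l.
  rewrite /X exchange_big; apply: eq_bigr => i _; apply: eq_bigr => j _.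
  by rewrite Esym.
rewrite {2}eX -big_split -sumrB mulr_suml; apply: eq_bigr => i _ /=.
rewrite -big_split -sumrB mulr_suml; apply: eq_bigr => j _ /=.
ring.
Qed.

Lemma tr_h_upper k : \sum_i h i k i = - D k Scal.
Proof.
under eq_bigr do rewrite hE.
rewrite sumrN; congr (- _).
under eq_bigr do (under eq_bigr do rewrite mulrBl mulrDl; rewrite sumrB big_split /=).
rewrite sumrB big_split /= /Scal D_gtrace gtraceE.
rewrite [X in _ - X]exchange_big addrAC.
have -> : \sum_i \sum_j cov2 i Ricci k j * E j i =
    \sum_(j < n) \sum_(i < n) cov2 j Ricci i k * E j i.
  by apply: eq_bigr => i _; apply: eq_bigr => j _; rewrite Esym (cov2_sym _ _ _ Ricci_tr).
rewrite subrr add0r; apply: eq_bigr => i _; apply: eq_bigr => j _.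
by rewrite mulrC Esym.
Qed.

Lemma dt_Lap f :
  dt (Lap f) = Lap (dt f) + (\tr (E *m Ricci *m E *m Hess f)) *+ 2.
Proof.
rewrite /Lap /gtrace D_trace map_mx_leibniz // mxtraceD dtE mulmxDl mxtraceD.
rewrite addrC; congr (_ + _).
have -> : map_mx dt (Hess f) = Hess (dt f) - \matrix_(i, j) (h i *m gradv f) j 0.
  apply/matrixP => i j; rewrite addmxE oppmxE [LHS]mxE ![Hess _ _ _]mxE.
  rewrite [(matrix_of_fun _ _) _ _]mxE /cov1 !(addmxE, oppmxE) raddfD raddfN /=.
  have -> : dt ((Gamma i *m gradv f) j 0) = (map_mx dt (Gamma i *m gradv f)) j 0.
    by rewrite [RHS]mxE.
  have dtdv : map_mx dt (gradv f) = gradv (dt f).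
    by apply/matrixP => a b; rewrite [LHS]mxE ![gradv _ _ _]mxE dtD.
  rewrite map_mx_leibniz // addmxE dtdv opprD addrA addrAC; congr (_ - _ - _).
    by rewrite [X in dt X]mxE [RHS]mxE ![gradv _ _ _]mxE !dtD.
  by rewrite [RHS]mxE.
rewrite mulmxBr raddfB /= -[X in _ - X]/(gtrace _) gtraceE.
have -> : \sum_i \sum_j E i j * (\matrix_(i, j) (h i *m gradv f) j 0) i j =
   \sum_k (\sum_i \sum_j E i j * h i j k) * gradv f k 0.
  under [RHS]eq_bigr do rewrite mulr_suml.
  rewrite [RHS]exchange_big; apply: eq_bigr => i _ /=.
  under [RHS]eq_bigr do rewrite mulr_suml.
  rewrite [RHS]exchange_big; apply: eq_bigr => j _ /=.
  rewrite [(matrix_of_fun _ _) _ _]mxE [(h i *m _) _ _]mxE mulr_sumr.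
  by apply: eq_bigr => k _; rewrite mulrA.
by rewrite big1 ?subr0 // => k _; rewrite tr_h mul0r.
Qed.

Lemma dt_ginner f : dt (ginner (gradv f) (gradv f)) =
  (ginner (gradv (dt f)) (gradv f) + gquad Ricci (gradv f)) *+ 2.
Proof.
have dtdv : map_mx dt (gradv f) = gradv (dt f).
  by apply/matrixP => a b; rewrite [LHS]mxE ![gradv _ _ _]mxE dtD.
rewrite [in LHS]/ginner /gtrace D_trace !map_mx_leibniz // mxtraceD dtE dtdv -map_trmx dtdv.
rewrite mulmxDr mulmxDl !mxtraceD -![\tr (E *m (_ *m _))]/(ginner _ _).
rewrite [ginner (gradv f) _]ginner_sym addrC mulrnDl; congr (_ + _); rewrite mulr2n.
suff -> : \tr (E *m Ricci *m E *m (gradv f *m (gradv f)^T)) = gquad Ricci (gradv f) by [].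
transitivity (ginner (Ricci *m E *m gradv f) (gradv f)); last by rewrite ginnerE.
by rewrite /ginner /gtrace !mulmxA.
Qed.

(** The variation of the Ricci tensor is the divergence of h minus the covariant
derivative of its trace.  The divergence is written with the connection term of
the upper index of h separated, so that each summand is a covariant derivative
of a 2-tensor. *)
Lemma dt_Ricci : map_mx dt Ricci = \sum_i cov2 i (\matrix_(j, k) h j k i)
  + \sum_i \sum_p Gamma i p i *: (\matrix_(j, k) h j k p) + Hess Scal.
Proof.
apply/matrixP => j k; rewrite !addmxE !summxE [LHS]mxE [Ricci _ _]mxE raddf_sum /=.
have dcurv i : dt (curv i j k i) =
    (D i (h j k i) + (h j *m Gamma i) k i - (Gamma i *m h j) k i - (h i *m Gamma j) k i)
    - (D j (h i k i) - (Gamma j *m h i) k i).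
  transitivity ((map_mx dt (curv i j)) k i); first by rewrite [RHS]mxE.
  have dd a b : map_mx dt (map_mx (D a) (Gamma b)) = map_mx (D a) (h b).
    by apply/matrixP => x y; rewrite [LHS]mxE [X in dt X]mxE dtD [RHS]mxE [in RHS]mxE.
  rewrite curvE !(map_mxD, map_mxN, map_mxB) !map_mx_leibniz // !dd !(addmxE, oppmxE).
  rewrite [(map_mx (D i) _) _ _]mxE [(map_mx (D j) _) _ _]mxE; ring.
under eq_bigr do rewrite dcurv.
rewrite sumrB; congr (_ + _); last first.
  rewrite sumrB -raddf_sum tr_h_upper -[RHS]opprK; congr (- _).
  rewrite [Hess _ _ _]mxE /cov1 addmxE oppmxE opprB [(map_mx _ _) _ _]mxE [gradv _ _ _]mxE.
  rewrite raddfN addrC; congr (_ - _).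
  under eq_bigr do rewrite mxE.
  rewrite exchange_big mxE -sumrN; apply: eq_bigr => p _ /=.
  by rewrite -mulr_sumr tr_h_upper mulrN opprK [gradv _ _ _]mxE.
rewrite !(big_split, sumrN) /=.
have -> : \sum_i (h i *m Gamma j) k i = \sum_i (Gamma i *m \matrix_(j, k) h j k i) j k.
  under eq_bigr do rewrite mxE.
  rewrite exchange_big; apply: eq_bigr => i _ /=.
  rewrite [RHS]mxE; apply: eq_bigr => p _.
  by rewrite [X in _ = _ * X]mxE mulrC Gamma_sym.
have -> : \sum_i (h j *m Gamma i) k i =
    \sum_i (\sum_p Gamma i p i *: (\matrix_(j, k) h j k p)) j k.
  apply: eq_bigr => i _; rewrite summxE [LHS]mxE; apply: eq_bigr => p _.
  by rewrite [RHS]mxE [X in _ = _ * X]mxE mulrC.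
have -> : \sum_i (Gamma i *m h j) k i = \sum_i ((\matrix_(j, k) h j k i) *m (Gamma i)^T) j k.
  apply: eq_bigr => i _; rewrite [LHS]mxE [RHS]mxE; apply: eq_bigr => p _.
  by rewrite [X in _ = X * _]mxE [X in _ = _ * X]mxE mulrC.
have -> : \sum_i (cov2 i (\matrix_(j, k) h j k i)) j k =
    \sum_i D i (h j k i) - \sum_i (Gamma i *m \matrix_(j, k) h j k i) j k
    - \sum_i ((\matrix_(j, k) h j k i) *m (Gamma i)^T) j k.
  rewrite -!sumrB; apply: eq_bigr => i _; rewrite /cov2 !(addmxE, oppmxE).
  by congr (_ - _ - _); rewrite [LHS]mxE [X in D i X]mxE.
have perm (x y z t : A) : x + y - z - t = x - t - z + y by ring.
exact: perm.
Qed.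

(** By [tr_h] all terms of [dt_Ricci] but the Hessian of the scalar curvature
have vanishing trace; the variation of the inverse metric gives 2 |Rc|^2. *)
Lemma dt_Scal : dt Scal = Lap Scal + gnormsq Ricci *+ 2.
Proof.
rewrite [in LHS]/Scal /gtrace D_trace map_mx_leibniz // mxtraceD addrC dtE; congr (_ + _).
  have tr0 p : gtrace (\matrix_(j, k) h j k p) = 0.
    rewrite gtraceE -[RHS](tr_h p); apply: eq_bigr => i _; apply: eq_bigr => j _.
    by rewrite [(matrix_of_fun _ _) _ _]mxE.
  rewrite dt_Ricci !mulmxDr !mulmx_sumr !mxtraceD !raddf_sum /=.
  rewrite big1 ?add0r => [|i _]; last by rewrite -[LHS]D_gtrace tr0 raddf0.
  rewrite big1 ?add0r // => i _; rewrite mulmx_sumr raddf_sum big1 // => p _ /=.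
  by rewrite -scalemxAr mxtraceZ -[\tr _]/(gtrace _) tr0 mulr0.
by rewrite mulmxDl mxtraceD mulr2n /gnormsq Ricci_tr.
Qed.

Definition const (k : A) := forall i, D i k = 0.

Lemma gradvD x y : gradv (x + y) = gradv x + gradv y.
Proof. by apply/matrixP => i j; rewrite addmxE ![gradv _ _ _]mxE raddfD. Qed.

Lemma gradvZ k x : const k -> gradv (k * x) = k *: gradv x.
Proof.
move=> kc; apply/matrixP => i j; rewrite [RHS]mxE ![gradv _ _ _]mxE.
by rewrite DM kc mul0r add0r.
Qed.

Lemma LapD x y : Lap (x + y) = Lap x + Lap y.
Proof.
rewrite /Lap /gtrace -mxtraceD -mulmxDr; congr (\tr (_ *m _)).
apply/matrixP => i j; rewrite addmxE ![Hess _ _ _]mxE gradvD -addmxE; congr (_ j 0).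
by rewrite /cov1 mulmxDr map_mxD opprD addrACA.
Qed.

Lemma LapZ k x : const k -> Lap (k * x) = k * Lap x.
Proof.
move=> kc; rewrite /Lap /gtrace -mxtraceZ scalemxAr; congr (\tr (_ *m _)).
apply/matrixP => i j; rewrite [RHS]mxE ![Hess _ _ _]mxE gradvZ // /cov1 -scalemxAr.
rewrite !(addmxE, oppmxE) mulrDr [in RHS]mulrN; congr (_ - _); rewrite !mxE.
  by rewrite DM kc mul0r add0r.
by [].
Qed.

Lemma ginnerDl V V' W : ginner (V + V') W = ginner V W + ginner V' W.
Proof. by rewrite /ginner /gtrace mulmxDl mulmxDr mxtraceD. Qed.

Lemma ginnerZl k V W : ginner (k *: V) W = k * ginner V W.
Proof. by rewrite /ginner /gtrace -scalemxAl -scalemxAr mxtraceZ. Qed.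

(** The evolution of P before the square is completed.  Time runs along t here,
hence the opposite sign; [th] is 1 / tau and [nu] the dimension. *)
Lemma dt_evolution u th al be a b c d nu :
  const al -> const be -> const a -> const b -> const c -> const d -> const nu ->
  const th ->
  dt al = 0 -> dt be = 0 -> dt a = 0 -> dt b = 0 -> dt d = 0 -> dt nu = 0 ->
  dt th = th * th ->
  let w := ginner (gradv u) (gradv u) in
  dt u = - (Lap u - w - c * Scal - half * nu * th) ->
  let P := al * Lap u - be * w + a * Scal + b * (u * th) + d * (nu * th) in
  dt P = - (Lap P - ginner (gradv P) (gradv u) *+ 2
    - (al - be) * gnormsq (Hess u) *+ 2
    - (al - be *+ 2) * gquad Ricci (gradv u) *+ 2
    + (a + be * c) * ginner (gradv Scal) (gradv u) *+ 2
    - (al * c + a *+ 2) * Lap Scal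
    - al * \tr (E *m Ricci *m E *m Hess u) *+ 2
    - a * gnormsq Ricci *+ 2
    + b * (w * th) - b * c * (Scal * th)
    - half * b * nu * (th * th) - b * (u * (th * th)) - d * (nu * (th * th))).
Proof.
move=> kal kbe ka kb kc kd knu kth tal tbe ta tb td tnu tth w eu P.
have kN x : const x -> const (- x) by move=> kx i; rewrite raddfN kx oppr0.
have kM x y : const x -> const y -> const (x * y).
  by move=> kx ky i; rewrite DM kx ky mul0r mulr0 addr0.
have khalf : const half by move=> i; rewrite half_const.
have eu' : dt u = - 1 * Lap u + w + c * Scal + half * nu * th by rewrite eu; ring.
have k1 : const (- 1) by apply: kN => i; exact: leibniz1.
have kt0 x : const x -> Lap x = 0 /\ gradv x = 0.
  move=> kx; have dx : gradv x = 0 by apply/matrixP => i j; rewrite mxE kx mxE.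
  split=> //; have -> : Lap x = gtrace 0; last by rewrite /gtrace mulmx0 raddf0.
  congr gtrace; apply/matrixP => i j; rewrite [LHS]mxE dx.
  by rewrite /cov1 mulmx0 raddf0 subr0 !mxE.
have LP : Lap P = al * Lap (Lap u) - be * Lap w + a * Lap Scal + b * th * Lap u.
  rewrite /P [u * th]mulrC !LapD -mulNr !LapZ //; last exact: kN.
  rewrite (kt0 th kth).1; ring.
have dP : gradv P = al *: gradv (Lap u) + (- be) *: gradv w
      + a *: gradv Scal + (b * th) *: gradv u.
  rewrite /P [u * th]mulrC !gradvD -mulNr !gradvZ //; last exact: kN.
  by rewrite (kt0 th kth).2 !scaler0 addr0 scalerA.
have ddtu : gradv (dt u) = (-1) *: gradv (Lap u) + gradv w + c *: gradv Scal.
  rewrite eu' !gradvD !gradvZ //; last exact: kM.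
  by rewrite (kt0 th kth).2 scaler0 addr0.
have Ldtu : Lap (dt u) = - Lap (Lap u) + Lap w + c * Lap Scal.
  rewrite eu' !LapD !LapZ //; last exact: kM.
  by rewrite (kt0 th kth).1 mulr0 addr0 mulN1r.
rewrite LP dP !ginnerDl !ginnerZl.
have dtk k x : dt k = 0 -> dt (k * x) = k * dt x.
  by move=> tk; rewrite dtM tk mul0r add0r.
rewrite /P !raddfD raddfN /= (dtk al) // (dtk be) // (dtk a) // (dtk b) //
  (dtk d) // (dtk nu) // dtM tth dt_Lap dt_Scal {2}/w dt_ginner.
rewrite Ldtu ddtu !ginnerDl !ginnerZl {1 2}/w bochner eu'.
ring.
Qed.

End Calculus.

(** * Smooth functions on open sets of a normed space *)
Section CkTheory.
Context {R : realType} {V : normedModType R}.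
Implicit Types (U : set V) (f h : V -> R).

Lemma near_open U f h x : open U -> U x -> (forall y, U y -> f y = h y) ->
  \forall y \near x, f y = h y.
Proof.
by move=> oU Ux e; apply: filterS (open_nbhs_nbhs (conj oU Ux)) => y /e.
Qed.

Lemma Ck_cont k U f x : Ck k U f -> U x -> {for x, continuous f}.
Proof. by case: k => [|k] [H _]; exact: H. Qed.

Lemma Ck_derivable k U f x w : Ck k.+1 U f -> U x -> derivable f x w.
Proof. by move=> [_ /(_ w) [H _]]; exact: H. Qed.

Lemma Ck_derive k U f w : Ck k.+1 U f -> Ck k U ('D_w f).
Proof. by move=> [_ /(_ w) []]. Qed.

Lemma Ck_eq k U f h : open U -> (forall x, U x -> f x = h x) ->
  Ck k U f -> Ck k U h.
Proof.
move=> oU; elim: k f h => [|k IH] f h e.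
  move=> [cf _]; split=> // x Ux.
  have ne := near_open oU Ux e.
  rewrite /prop_for /continuous_at -(e _ Ux).
  by apply: cvg_trans (cf x Ux); apply: near_eq_cvg.
move=> [cf df]; split.
  move=> x Ux; have ne := near_open oU Ux e.
  rewrite /prop_for /continuous_at -(e _ Ux).
  by apply: cvg_trans (cf x Ux); apply: near_eq_cvg.
move=> w; have [d1 d2] := df w; split.
  by move=> x Ux; apply: near_eq_derivable (d1 x Ux); exact: near_open Ux e.
apply: IH d2 => x Ux; apply: near_eq_derive; exact: near_open Ux e.
Qed.

Lemma CkS k U f : Ck k.+1 U f -> Ck k U f.
Proof.
elim: k f => [|k IH] f [cf df]; first by split.
split=> // w; have [d1 d2] := df w; split=> //; exact: IH.
Qed.

Lemma Ck_sub k U U' f : U' `<=` U -> Ck k U f -> Ck k U' f.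
Proof.
move=> sU; elim: k f => [|k IH] f [cf df]; first by split=> [x /sU /cf|].
split=> [x /sU /cf //|]; move=> w; have [d1 d2] := df w; split; first by move=> x /sU /d1.
exact: IH.
Qed.

Lemma Ck_cst k U (c : R) : open U -> Ck k U (cst c).
Proof.
move=> oU; elim: k c => [|k IH] c.
  by split=> [x _|//]; apply: cst_continuous.
split=> [x _|]; first exact: cst_continuous.
move=> w; split; first by move=> x _; exact: derivable_cst.
by apply: Ck_eq (IH 0) => // x _; rewrite derive_cst.
Qed.

Lemma CkD k U f h : open U -> Ck k U f -> Ck k U h -> Ck k U (f + h).
Proof.
move=> oU; elim: k f h => [|k IH] f h [cf df] [ch dh].
  split=> [x Ux|//]; apply: continuousD; [exact: cf|exact: ch].
split=> [x Ux|]; first by apply: continuousD; [exact: cf|exact: ch].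
move=> w; have [d1 d2] := df w; have [e1 e2] := dh w; split.
  by move=> x Ux; apply: derivableD; [exact: d1|exact: e1].
apply: Ck_eq (IH _ _ d2 e2) => // x Ux.
by rewrite deriveD //; [exact: d1|exact: e1].
Qed.

Lemma CkM k U f h : open U -> Ck k U f -> Ck k U h -> Ck k U (f * h).
Proof.
move=> oU; elim: k f h => [|k IH] f h sf sh.
  split=> [x Ux|//].
  by apply: continuousM; [exact: Ck_cont sf Ux|exact: Ck_cont sh Ux].
split=> [x Ux|].
  by apply: continuousM; [exact: Ck_cont sf Ux|exact: Ck_cont sh Ux].
move=> w; split.
  by move=> x Ux; apply: derivableM; apply: Ck_derivable Ux; eassumption.
have s1 := IH _ _ (CkS sf) (Ck_derive w sh).
have s2 := IH _ _ (CkS sh) (Ck_derive w sf).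
apply: Ck_eq (CkD oU s1 s2) => // x Ux.
by rewrite deriveM //; apply: Ck_derivable Ux; eassumption.
Qed.

Lemma CkV k U f : open U -> (forall x, U x -> f x != 0) -> Ck k U f ->
  Ck k U (fun x => (f x)^-1).
Proof.
move=> oU f0; elim: k f f0 => [|k IH] f f0 sf.
  split=> [x Ux|//].
  by apply: continuousV; [exact: f0|exact: Ck_cont sf Ux].
split=> [x Ux|]; first by apply: continuousV; [exact: f0|exact: Ck_cont sf Ux].
move=> w; split.
  by move=> x Ux; apply: derivableV; [exact: f0|exact: Ck_derivable sf Ux].
have s1 := IH _ f0 (CkS sf).
have s2 := CkM oU (Ck_cst k (-1) oU) (CkM oU (CkM oU s1 s1) (Ck_derive w sf)).
apply: Ck_eq s2 => // x Ux.
rewrite deriveV //; [|exact: f0|exact: Ck_derivable sf Ux].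
transitivity (-1 * ((f x)^-1 * (f x)^-1 * 'D_w f x)) => //.
by rewrite mulN1r -expr2 exprVn scaleNr.
Qed.

Lemma is_derive_line f (p v : V) (s : R) : derivable f (s *: v + p) v ->
  is_derive s 1 (fun t : R => f (t *: v + p)) ('D_v f (s *: v + p)).
Proof.
have e : (fun h : R => h^-1 *: (f ((h%:A + s) *: v + p) - f (s *: v + p))) =
   (fun h : R => h^-1 *: (f (h *: v + (s *: v + p)) - f (s *: v + p))).
  by apply/funext => h; rewrite scalerDl addrA [_%:A]mulr1.
move=> df; split; first by rewrite /derivable /= e.
by rewrite /derive /= e.
Qed.

Lemma MVT_line f (p v : V) (r : R) : 0 <= r ->
  (forall s, s \in `[0, r]%R -> derivable f (s *: v + p) v) ->
  exists2 s, s \in `[0, r]%R & f (r *: v + p) - f p = 'D_v f (s *: v + p) * r.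
Proof.
move=> r0 df; set F := fun t : R => f (t *: v + p).
have [||s s01 e] := @MVT_segment _ F (fun s => 'D_v f (s *: v + p)) 0 r r0.
- move=> s s0r; apply: is_derive_line; apply: df.
  exact: subset_itv_oo_cc.
- apply: derivable_within_continuous => s /df /is_derive_line []; done.
by exists s => //; rewrite subr0 in e; rewrite -e /F scale0r add0r.
Qed.

(** Two applications of the mean value theorem, first along v to the difference
of f in direction w, then along w to the derivative along v. *)
Lemma second_difference k U f (x v w : V) (r : R) : Ck k.+2 U f -> 0 <= r ->
  (forall s t, s \in `[0, r]%R -> t \in `[0, r]%R -> U (s *: v + t *: w + x)) ->
  exists s t, [/\ s \in `[0, r]%R, t \in `[0, r]%R &
    f (r *: v + r *: w + x) - f (r *: v + x) - f (r *: w + x) + f x =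
    'D_w ('D_v f) (s *: v + t *: w + x) * r * r].
Proof.
move=> sf r0 HU.
have z0 : 0 \in `[0, r]%R by rewrite in_itv /= lexx r0.
have rr : r \in `[0, r]%R by rewrite in_itv /= lexx r0.
set F := fun y => f (r *: w + y) - f y.
have der y : U y -> derivable f y v by move=> Uy; exact: Ck_derivable sf Uy.
have shift y : derivable f (r *: w + y) v ->
    is_derive y v (fun y => f (r *: w + y)) ('D_v f (r *: w + y)).
  move=> d.
  have e : (fun h : R => h^-1 *: (f (r *: w + (h *: v + y)) - f (r *: w + y))) =
     (fun h : R => h^-1 *: (f (h *: v + (r *: w + y)) - f (r *: w + y))).
    by apply/funext => h; rewrite addrCA.
  split; first by rewrite /derivable /= e.
  by rewrite /derive /= e.
have HUs s : s \in `[0, r]%R -> U (s *: v + x) /\ U (r *: w + (s *: v + x)).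
  move=> s0; split; first by have := HU s 0 s0 z0; rewrite scale0r addr0.
  by have := HU s r s0 rr; rewrite addrA [r *: w + _]addrC.
have dF s : s \in `[0, r]%R -> is_derive (s *: v + x) v F
    ('D_v f (r *: w + (s *: v + x)) - 'D_v f (s *: v + x)).
  move=> /HUs [U1 U2]; apply: is_deriveB; first exact: shift (der _ U2).
  exact/derivableP/der.
have [|s s0 es] := @MVT_line F x v r r0.
  by move=> s /dF [].
have [|t t0 et] := @MVT_line ('D_v f) (s *: v + x) w r r0.
  move=> t t0; apply: Ck_derivable (Ck_derive v sf) _.
  by rewrite addrA [t *: w + _]addrC; exact: HU.
have comm a b : a *: w + (b *: v + x) = b *: v + a *: w + x.
  by rewrite addrCA addrA.
rewrite !comm in et; rewrite (@derive_val _ _ _ _ _ _ _ (dF s s0))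
  /F !comm et in es.
exists s, t; split=> //.
transitivity (f (r *: v + r *: w + x) - f (r *: v + x)
  - (f (r *: w + x) - f x)) => //.
by rewrite opprD opprK addrA.
Qed.

(** Continuity reduces an equality of values at x to an equality of values at two
points arbitrarily close to x, which may be different ones. *)
Lemma continuous_coincide (F G : V -> R) (x : V) :
  {for x, continuous F} -> {for x, continuous G} ->
  (forall N : set V, nbhs x N -> exists p q, [/\ N p, N q & F p = G q]) ->
  F x = G x.
Proof.
move=> cF cG H; apply/eqP; apply: contraT => AB.
have e0 : 0 < `|F x - G x| / 2 by rewrite divr_gt0 // normr_gt0 subr_eq0.
move/cvgrPdist_lt : cF => /(_ _ e0) n1; move/cvgrPdist_lt : cG => /(_ _ e0) n2.
have [p [q [[h1 _] [_ h2] e]]] := H _ (filterI n1 n2).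
have : `|F x - G x| < `|F x - G x|; last by rewrite ltxx.
have h := ltrD h1 h2; rewrite -splitr e -(normrN (G x - _)) in h.
apply: le_lt_trans h.
apply: le_trans (ler_normD _ _); rewrite le_eqVlt; apply/orP; left.
by apply/eqP; congr `|_|; rewrite opprB addrA subrK.
Qed.

(** The second difference is symmetric in v and w, so both mixed derivatives take
a common value near x. *)
Lemma schwarz k U f (x v w : V) : open U -> U x -> Ck k.+2 U f ->
  'D_w ('D_v f) x = 'D_v ('D_w f) x.
Proof.
move=> oU Ux sf.
apply: (@continuous_coincide ('D_w ('D_v f)) ('D_v ('D_w f)) x).
- exact: Ck_cont (Ck_derive w (Ck_derive v sf)) Ux.
- exact: Ck_cont (Ck_derive v (Ck_derive w sf)) Ux.
move=> N Nx.
have /nbhs_ballP[d /= d0 Hd] : nbhs x (U `&` N).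
  by apply: filterI => //; exact: open_nbhs_nbhs.
set c := `|v| + `|w| + 1.
have c0 : 0 < c by rewrite ltr_wpDl // addr_ge0.
pose r := d / 2 / c.
have r0 : 0 < r by rewrite !divr_gt0.
have HN s t : s \in `[0, r]%R -> t \in `[0, r]%R ->
    (U `&` N) (s *: v + t *: w + x).
  rewrite !in_itv /= => /andP[s0 sr] /andP[t0 tr]; apply: Hd.
  rewrite -ball_normE /ball_ /= opprD addrCA subrr addr0 normrN.
  apply: le_lt_trans (ler_normD _ _) _; rewrite !normrZ !ger0_norm //.
  apply: (@le_lt_trans _ _ (r * c)).
    rewrite /c !mulrDr mulr1 -[leLHS]addr0 lerD ?(ltW r0) //.
    by rewrite lerD ?ler_wpM2r.
  by rewrite /r divfK ?gt_eqF // ltr_pdivrMr // ltr_pMr // ltr1n.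
have HU s t : s \in `[0, r]%R -> t \in `[0, r]%R -> U (s *: v + t *: w + x).
  by move=> s0 t0; have [] := HN _ _ s0 t0.
have HU' s t : s \in `[0, r]%R -> t \in `[0, r]%R -> U (s *: w + t *: v + x).
  by move=> s0 t0; rewrite (addrC (s *: w)); exact: HU.
have [s [t [s0 t0 e1]]] := second_difference sf (ltW r0) HU.
have [t' [s' [t'0 s'0 e2]]] := second_difference sf (ltW r0) HU'.
exists (s *: v + t *: w + x), (t' *: w + s' *: v + x); split.
- by have [] := HN _ _ s0 t0.
- by rewrite (addrC (t' *: w)); have [] := HN _ _ s'0 t'0.
have rn0 : r != 0 by rewrite gt_eqF.
rewrite (addrC (r *: w) (r *: v)) (addrAC _ (- f (r *: w + x))) e1 in e2.
by have := mulIf rn0 (mulIf rn0 e2).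
Qed.

End CkTheory.

(** * The ring of smooth functions and its derivations *)
Section SmoothRing.
Context {R : realType} {V : normedModType R} (A : set V).
Implicit Types F G h : V -> R.

(** The data behind [smooth_on]: h is a smooth extension of F around the points
of U.  Working with a named pair (U, h) allows all derivatives of F at the
points of U to be computed from one and the same h. *)
Definition smooth_rep F (U : set V) h :=
  [/\ open U, forall k, Ck k U h & forall y, A y -> U y -> F y = h y].

Lemma smooth_onP F : smooth_on A F <->
  (forall x, A x -> exists U h, U x /\ smooth_rep F U h).
Proof.
split=> H x /H [U [h]]; first by move=> [oU Ux sh e]; exists U, h.
by move=> [Ux [oU sh e]]; exists U, h.
Qed.

Lemma smooth_repD F G U U' h h' : smooth_rep F U h -> smooth_rep G U' h' ->
  smooth_rep (F + G) (U `&` U') (h + h').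
Proof.
move=> [oU sh e] [oU' sh' e']; have oI : open (U `&` U') by exact: openI.
split=> // [k|y Ay [Uy Uy']]; last by rewrite /GRing.add/= e // e'.
apply: CkD => //; [apply: Ck_sub (sh k)|apply: Ck_sub (sh' k)].
- exact: subIsetl.
- exact: subIsetr.
Qed.

Lemma smooth_repM F G U U' h h' : smooth_rep F U h -> smooth_rep G U' h' ->
  smooth_rep (F * G) (U `&` U') (h * h').
Proof.
move=> [oU sh e] [oU' sh' e']; have oI : open (U `&` U') by exact: openI.
split=> // [k|y Ay [Uy Uy']]; last by rewrite /GRing.mul/= e // e'.
apply: CkM => //; [apply: Ck_sub (sh k)|apply: Ck_sub (sh' k)].
- exact: subIsetl.
- exact: subIsetr.
Qed.

Lemma smooth_onD F G : smooth_on A F -> smooth_on A G -> smooth_on A (F + G).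
Proof.
move=> /smooth_onP sF /smooth_onP sG; apply/smooth_onP => x Ax.
have [U [h [Ux r]]] := sF x Ax; have [U' [h' [Ux' r']]] := sG x Ax.
by exists (U `&` U'), (h + h'); split; [|exact: smooth_repD].
Qed.

Lemma smooth_onM F G : smooth_on A F -> smooth_on A G -> smooth_on A (F * G).
Proof.
move=> /smooth_onP sF /smooth_onP sG; apply/smooth_onP => x Ax.
have [U [h [Ux r]]] := sF x Ax; have [U' [h' [Ux' r']]] := sG x Ax.
by exists (U `&` U'), (h * h'); split; [|exact: smooth_repM].
Qed.

Lemma smooth_on_cst c : smooth_on A (cst c).
Proof.
move=> x Ax; exists setT, (cst c); split=> //; first exact: openT.
by move=> k; apply: Ck_cst; exact: openT.
Qed.

Lemma smooth_on_eq F G : (forall x, A x -> F x = G x) -> smooth_on A F -> smooth_on A G.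
Proof.
move=> e sF x Ax; have [U [h [oU Ux sh e']]] := sF x Ax.
by exists U, h; split=> // y Ay Uy; rewrite -e // e'.
Qed.

Lemma smooth_onV F : (forall x, A x -> F x != 0) -> smooth_on A F ->
  smooth_on A (fun x => (F x)^-1).
Proof.
move=> F0 sF x Ax; have [U [h [oU Ux sh e]]] := sF x Ax.
have ch : {for x, continuous h} by exact: Ck_cont (sh 0) Ux.
have hx : h x != 0 by rewrite -e // F0.
have : nbhs x [set y | h y != 0 /\ U y].
  apply: filterI; last exact: open_nbhs_nbhs.
  by apply: cvgr_neq0 hx; exact: ch.
rewrite nbhsE => -[W [oW Wx] sW].
exists W, (fun y => (h y)^-1); split=> //.
- move=> k; apply: CkV => // [y /sW[]//|].
  by apply: Ck_sub (sh k) => y /sW[].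
- by move=> y Ay /sW[_ Uy]; rewrite e.
Qed.

Definition smooth_pred : {pred V -> R} := [pred F | `[< smooth_on A F >]].

Record smooth_fun := SmoothFun { sf_val :> V -> R ; sf_valP : sf_val \in smooth_pred }.

HB.instance Definition _ := [isSub for sf_val].
HB.instance Definition _ := [Choice of smooth_fun by <:].

Lemma smooth_subring_closed : subring_closed smooth_pred.
Proof.
split=> [|F G|F G]; rewrite !inE.
- by move: (smooth_on_cst 1).
- move=> sF sG; apply: smooth_onD => //.
  apply: smooth_on_eq (smooth_onM (smooth_on_cst (-1)) sG) => x _.
  by rewrite /GRing.mul/= mulN1r.
- exact: smooth_onM.
Qed.

HB.instance Definition _ :=
  GRing.isSubringClosed.Build (V -> R) smooth_pred smooth_subring_closed.
HB.instance Definition _ := [SubChoice_isSubComNzRing of smooth_fun by <:].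

Lemma sfP (F : smooth_fun) : smooth_on A F.
Proof. by have /asboolP := sf_valP F. Qed.

Definition mk_sf F (sF : smooth_on A F) : smooth_fun :=
  @SmoothFun F (asboolT sF).

Lemma sf_eq (F G : smooth_fun) : (forall z, F z = G z) -> F = G.
Proof. by move=> e; apply/val_inj/funext. Qed.

Lemma sfD (F G : smooth_fun) z : (F + G) z = F z + G z. Proof. by []. Qed.
Lemma sfN (F : smooth_fun) z : (- F) z = - F z. Proof. by []. Qed.
Lemma sfM (F G : smooth_fun) z : (F * G) z = F z * G z. Proof. by []. Qed.
Lemma sf0 z : (0 : smooth_fun) z = 0. Proof. by []. Qed.
Lemma sf1 z : (1 : smooth_fun) z = 1. Proof. by []. Qed.

(** A derivation of the ring that differentiates every representative in the
fixed direction w.  Requiring the value 0 off A makes the ring identities below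
hold at every point, hence as equalities between elements of the ring. *)
Definition directional (w : V) (d : smooth_fun -> smooth_fun) :=
  (forall (F : smooth_fun) U h, smooth_rep F U h -> smooth_rep (d F) U ('D_w h)) /\
  (forall (F : smooth_fun) z, ~ A z -> d F z = 0).

Lemma rep_ex (F : smooth_fun) z : A z -> exists U h, U z /\ smooth_rep F U h.
Proof. by move=> Az; have /smooth_onP := sfP F; apply. Qed.

Lemma rep_val (F : smooth_fun) U h z : smooth_rep F U h -> U z -> A z -> F z = h z.
Proof. by move=> [_ _ e] Uz Az; exact: e. Qed.

Lemma rep_derivable F U h z w : smooth_rep F U h -> U z -> derivable h z w.
Proof. by move=> [_ sh _]; exact: Ck_derivable (sh 1). Qed.

Lemma directionalD w d : directional w d -> {morph d : F G / F + G}.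
Proof.
move=> [dr d0] F G; apply: sf_eq => z.
have [Az|Az] := pselect (A z); last by rewrite sfD !d0 // addr0.
have [U [h [Uz r]]] := rep_ex F Az; have [U' [h' [Uz' r']]] := rep_ex G Az.
rewrite sfD (rep_val (dr (F + G) _ _ (smooth_repD r r')) (conj Uz Uz') Az).
rewrite (rep_val (dr _ _ _ r) Uz Az) (rep_val (dr _ _ _ r') Uz' Az).
by rewrite deriveD //; [exact: rep_derivable r Uz|exact: rep_derivable r' Uz'].
Qed.

Lemma directionalM w d (F G : smooth_fun) : directional w d -> d (F * G) = d F * G + F * d G.
Proof.
move=> [dr d0]; apply: sf_eq => z; have [Az|Az] := pselect (A z); last first.
  by rewrite sfD !sfM !d0 // mul0r mulr0 addr0.
have [U [h [Uz r]]] := rep_ex F Az; have [U' [h' [Uz' r']]] := rep_ex G Az.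
rewrite sfD !sfM (rep_val (dr (F * G) _ _ (smooth_repM r r')) (conj Uz Uz') Az).
rewrite (rep_val (dr _ _ _ r) Uz Az) (rep_val (dr _ _ _ r') Uz' Az).
rewrite (rep_val r Uz Az) (rep_val r' Uz' Az).
rewrite deriveM //; [|exact: rep_derivable r Uz|exact: rep_derivable r' Uz'].
by rewrite addrC; congr (_ + _); rewrite [LHS]mulrC.
Qed.

(** Both orders of differentiation are read off the same representative, to
which the symmetry of second derivatives applies.  This covers one-sided time
derivatives at an end point of the time interval, as the representative is
defined on both sides of it. *)
Lemma directionalC w w' d d' (F : smooth_fun) : directional w d -> directional w' d' ->
  d (d' F) = d' (d F).
Proof.
move=> [dr d0] [dr' d0']; apply: sf_eq => z.
have [Az|Az] := pselect (A z); last by rewrite d0 // d0'.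
have [U [h [Uz r]]] := rep_ex F Az; have [oU sh _] := r.
rewrite (rep_val (dr _ _ _ (dr' _ _ _ r)) Uz Az).
rewrite (rep_val (dr' _ _ _ (dr _ _ _ r)) Uz Az).
exact: schwarz oU Uz (sh 2).
Qed.

Lemma directional_zmod w d : directional w d -> zmod_morphism d.
Proof.
move=> dd x y; rewrite -[in RHS](subrK y x).
by rewrite [in RHS](directionalD dd) addrK.
Qed.

Definition evz (z : V) (F : smooth_fun) : R := F z.

Lemma evz_is_zmod z : zmod_morphism (evz z).
Proof. by []. Qed.
Lemma evz_is_mul z : monoid_morphism (evz z).
Proof. by []. Qed.
HB.instance Definition _ z := GRing.isZmodMorphism.Build _ _ (evz z) (evz_is_zmod z).
HB.instance Definition _ z := GRing.isMonoidMorphism.Build _ _ (evz z) (evz_is_mul z).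

End SmoothRing.

(** * Derivatives in space and in time *)
Section Slices.
Context {R : realType} {n : nat}.
Notation W := ('rV[R]_n * R)%type.
Implicit Types (h : W -> R) (x e : 'rV[R]_n) (t : R).

Lemma slice_space_quot h x t e :
  (fun s : R => s^-1 *: (h (s *: e + x, t) - h (x, t))) =
  (fun s : R => s^-1 *: (h (s *: (e, 0 : R) + (x, t)) - h (x, t))).
Proof.
apply/funext => s; congr (_ *: (h _ - _)).
transitivity (s *: e + x, s *: (0 : R^o) + t); last reflexivity.
by rewrite scaler0 add0r.
Qed.

Lemma derive_slice_space h x t e :
  'D_e (fun y => h (y, t)) x = 'D_(e, 0 : R) h (x, t).
Proof. by rewrite /derive /= slice_space_quot. Qed.

Lemma slice_time_quot h x t :
  (fun s : R => s^-1 *: (h (x, s%:A + t) - h (x, t))) =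
  (fun s : R => s^-1 *: (h (s *: (0 : 'rV[R]_n, 1 : R) + (x, t)) - h (x, t))).
Proof.
apply/funext => s; congr (_ *: (h _ - _)).
transitivity (s *: (0 : 'rV[R]_n) + x, s%:A + t); last reflexivity.
by rewrite scaler0 add0r.
Qed.

Lemma Ck_time k (U : set W) : open U -> Ck k U (fun z : W => z.2).
Proof.
have der (z w : W) : is_derive z w (fun z : W => z.2 : R^o) w.2.
  have e : (fun h : R => h^-1 *: ((h *: w + z).2 - z.2)) @ 0^' --> w.2.
    have E : \forall h \near 0^', w.2 = h^-1 *: ((h *: w + z).2 - z.2).
      near=> h; have h0 : h != 0 by near: h; exact: nbhs_dnbhs_neq.
      transitivity (h^-1 *: (h *: w.2 + z.2 - z.2)) => //.
      by rewrite addrK scalerA mulVf // scale1r.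
    apply: (@cvg_trans _ (cst w.2 @ 0^')); last exact: cvg_cst.
    exact: near_eq_cvg E.
  split; first by apply/cvg_ex; exists w.2.
  exact: cvg_lim e.
move=> oU; have c (z : W) : {for z, continuous (fun z : W => z.2)} by exact: cvg_snd.
case: k => [|k]; first by split=> // z _; exact: c.
split=> [z _|w]; first exact: c.
split=> [z _|]; first by have [] := der z w.
by apply: Ck_eq (Ck_cst k w.2 oU) => // z _; rewrite (@derive_val _ _ _ _ _ _ _ (der z w)).
Unshelve. all: by end_near. Qed.

End Slices.

Section TimeDerivative.
Context {R : realType}.
Implicit Types (I : set R) (f : R -> R) (t l : R).

Lemma has_dt_eq I f f' t l : f t = f' t ->
  (\forall s \near t, I s -> f s = f' s) -> has_dt I f t l -> has_dt I f' t l.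
Proof.
move=> et e H; apply: cvg_trans H; apply: near_eq_cvg.
rewrite near_withinE; near=> s; move=> [Is _].
by rewrite et (near e s).
Unshelve. all: by end_near. Qed.

(** At an end point of I the one-sided derivative is the two-sided one of the
function f, which is defined around t. *)
Lemma derivable_has_dt I f t : derivable f t 1 -> has_dt I f t ('D_1 f t).
Proof.
move=> df.
have H : (fun h : R => h^-1 *: (f (h%:A + t) - f t)) h @[h --> 0^'] --> 'D_1 f t.
  exact: df.
have S : (fun s => s - t) @ within (I `\ t) (nbhs t) --> 0^'.
  move=> P; rewrite /dnbhs /within /= => /nbhs_ballP[e /= e0 HP].
  apply/nbhs_ballP; exists e => //= s ts [Is st]; apply: HP.
    by move: ts; rewrite -!ball_normE /ball_ /= sub0r opprB.
  by rewrite subr_eq0; apply/eqP.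
have := cvg_comp _ _ S H; apply: cvg_trans; apply: near_eq_cvg; near=> s => /=.
by rewrite [_%:A]mulr1 subrK mulrC.
Unshelve. all: by end_near. Qed.

(** The condition under which limits along I at points of I are unique. *)
Definition accum I := forall t, I t -> ProperFilter (within (I `\ t) (nbhs t)).

Lemma accum_itvco (T : R) : accum `[0, T[%classic.
Proof.
move=> t; rewrite /= in_itv /= => /andP[t0 tT].
apply: Build_ProperFilter => /nbhs_ballP[e /= e0 H].
pose d := Num.min (e / 2) ((T - t) / 2).
have d0 : 0 < d by rewrite lt_min !divr_gt0 // subr_gt0.
have de : d < e.
  apply: (@le_lt_trans _ _ (e / 2)); first by rewrite ge_min lexx.
  by rewrite ltr_pdivrMr // ltr_pMr // ltr1n.
have dT : t + d < T.
  rewrite -ltrBrDl; apply: (@le_lt_trans _ _ ((T - t) / 2)).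
    by rewrite ge_min lexx orbT.
  by rewrite ltr_pdivrMr // ltr_pMr ?ltr1n // subr_gt0.
apply: (H (t + d)).
  by rewrite -ball_normE /ball_ /= opprD addrA subrr add0r normrN gtr0_norm.
split; first by rewrite /= in_itv /= dT addr_ge0 // ltW.
by move=> /= /eqP; rewrite -subr_eq0 addrAC subrr add0r gt_eqF.
Qed.

End TimeDerivative.

Section SpaceTime.
Context {R : realType} {n : nat} (Om : set 'rV[R]_n) (oOm : open Om) (T : R).
Notation W := ('rV[R]_n * R)%type.
Notation I := (`[0, T[%classic : set R).
Notation A := (Om `*` I : set W).
Notation SF := (smooth_fun A).
Implicit Types (F : W -> R).

Definition dspace (i : 'I_n) F : W -> R := fun z =>
  if z \in A then pd i (fun y => F (y, z.2)) z.1 else 0.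

Definition dtime F : W -> R := fun z =>
  if z \in A then
    lim ((F (z.1, s) - F z) / (s - z.2) @[s --> within (I `\ z.2) (nbhs z.2)])
  else 0.

Lemma near_slice_space (U : set W) x t : open U -> U (x, t) -> Om x ->
  \forall y \near x, U (y, t) /\ Om y.
Proof.
move=> oU Ux Ox; apply: filterI; last exact: open_nbhs_nbhs.
have [[P Q] /= [nP nQ] sPQ] : nbhs (x, t) U by exact: open_nbhs_nbhs.
by apply: filterS nP => y Py; apply: sPQ; split=> //; exact: nbhs_singleton nQ.
Qed.

Lemma near_slice_time (U : set W) x t : open U -> U (x, t) ->
  \forall s \near t, U (x, s).
Proof.
move=> oU Ux.
have [[P Q] /= [nP nQ] sPQ] : nbhs (x, t) U by exact: open_nbhs_nbhs.
by apply: filterS nQ => s Qs; apply: sPQ; split=> //; exact: nbhs_singleton nP.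
Qed.

Lemma rep_pd F U h i z : smooth_rep A F U h -> U z -> A z ->
  pd i (fun y => F (y, z.2)) z.1 = 'D_(delta_mx 0 i, 0 : R) h z.
Proof.
case: z => x t [oU sh e] Uz [/= Ox It].
rewrite -derive_slice_space /pd /=; apply: near_eq_derive.
by apply: filterS (near_slice_space oU Uz Ox) => y [Uy Oy]; exact: e.
Qed.

Lemma rep_has_dt F U h z : smooth_rep A F U h -> U z -> A z ->
  has_dt I (fun s => F (z.1, s)) z.2 ('D_(0 : 'rV[R]_n, 1 : R) h z).
Proof.
case: z => x t [oU sh e] Uz [/= Ox It].
have dh : derivable h (x, t) (0 : 'rV[R]_n, 1 : R) by exact: Ck_derivable (sh 1) Uz.
have -> : 'D_(0 : 'rV[R]_n, 1 : R) h (x, t) = 'D_1 (fun s => h (x, s)) t.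
  by rewrite /derive /= slice_time_quot.
apply: (@has_dt_eq _ _ (fun s => h (x, s))); first by rewrite e.
  by apply: filterS (near_slice_time oU Uz) => s Us Is; rewrite e.
by apply: derivable_has_dt; rewrite /derivable /= slice_time_quot.
Qed.

Lemma dtime_has_dt F z l : A z -> has_dt I (fun s => F (z.1, s)) z.2 l -> dtime F z = l.
Proof.
case: z => x t [/= Ox It] H; rewrite /dtime ifT; last by rewrite inE.
have PF := accum_itvco It.
exact: cvg_lim H.
Qed.

Lemma rep_dspace F U h i : smooth_rep A F U h ->
  smooth_rep A (dspace i F) U ('D_(delta_mx 0 i, 0 : R) h).
Proof.
move=> r; have [oU sh e] := r; split=> //.
  by move=> k; apply: Ck_derive (sh k.+1).
move=> y Ay Uy; rewrite /dspace ifT ?inE //; exact: rep_pd r Uy Ay.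
Qed.

Lemma rep_dtime F U h : smooth_rep A F U h ->
  smooth_rep A (dtime F) U ('D_(0 : 'rV[R]_n, 1 : R) h).
Proof.
move=> r; have [oU sh e] := r; split=> //.
  by move=> k; apply: Ck_derive (sh k.+1).
move=> y Ay Uy; apply: dtime_has_dt => //; exact: rep_has_dt r Uy Ay.
Qed.

Lemma smooth_dspace F i : smooth_on A F -> smooth_on A (dspace i F).
Proof.
move=> /smooth_onP sF; apply/smooth_onP => z /sF [U [h [Uz r]]].
by exists U; eexists; split; [|exact: rep_dspace r].
Qed.

Lemma smooth_dtime F : smooth_on A F -> smooth_on A (dtime F).
Proof.
move=> /smooth_onP sF; apply/smooth_onP => z /sF [U [h [Uz r]]].
by exists U; eexists; split; [|exact: rep_dtime r].
Qed.

Definition Dspace i (F : SF) : SF := mk_sf (smooth_dspace i (sfP F)).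
Definition Dtime (F : SF) : SF := mk_sf (smooth_dtime (sfP F)).

Lemma dspace_out i F z : ~ A z -> dspace i F z = 0.
Proof. by move=> Az; rewrite /dspace ifF //; apply: memNset. Qed.

Lemma dtime_out F z : ~ A z -> dtime F z = 0.
Proof. by move=> Az; rewrite /dtime ifF //; apply: memNset. Qed.

Lemma directional_Dspace i : directional (delta_mx 0 i, 0 : R) (Dspace i).
Proof. by split=> [F U h|F z]; [exact: rep_dspace|exact: dspace_out]. Qed.

Lemma directional_Dtime : directional (0 : 'rV[R]_n, 1 : R) Dtime.
Proof. by split=> [F U h|F z]; [exact: rep_dtime|exact: dtime_out]. Qed.

HB.instance Definition _ i :=
  GRing.isZmodMorphism.Build _ _ (Dspace i) (directional_zmod (directional_Dspace i)).
HB.instance Definition _ :=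
  GRing.isZmodMorphism.Build _ _ Dtime (directional_zmod directional_Dtime).

End SpaceTime.

(** * Contractions at a point *)
Section Contractions.
Context {R : realType} {n : nat}.
Notation B E X Y := (\tr (E *m X *m E *m Y)).

Lemma posdef_unit m (G : 'M[R]_m) :
  (forall w : 'rV[R]_m, w != 0 -> 0 < (w *m G *m w^T) 0 0) -> G \in unitmx.
Proof.
move=> pG; rewrite unitmxE unitfE; apply/negP => /det0P[w w0 wG].
by have := pG w w0; rewrite wG mul0mx mxE ltxx.
Qed.

Lemma trgE (G X : 'M[R]_n) : (invmx G)^T = invmx G -> trg G X = \tr (invmx G *m X).
Proof.
move=> Es; rewrite mxtraceE [RHS]exchange_big; apply: eq_bigr => i _.
by apply: eq_bigr => j _; rewrite -{1}Es mxE.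
Qed.

Lemma normsqgE (G X : 'M[R]_n) : (invmx G)^T = invmx G ->
  normsqg G X = B (invmx G) X X^T.
Proof.
set E := invmx G => Es.
rewrite mxtraceE; apply: eq_bigr => i _; apply: eq_bigr => j _.
rewrite [in RHS]mxE mulr_suml exchange_big; apply: eq_bigr => l _ /=.
rewrite [in RHS]mxE !mulr_suml; apply: eq_bigr => k _.
rewrite [_^T _ _]mxE -/E -{1}Es [E^T _ _]mxE.
have -> : E j l = E l j by rewrite -{1}Es mxE.
have -> : E k i = E i k by rewrite -{1}Es mxE.
ring.
Qed.

Lemma contrgE (G X : 'M[R]_n) (w : 'rV[R]_n) :
  contrg G X w w = gquad (invmx G) X w^T.
Proof.
set E := invmx G.
apply: eq_bigr => i _.
transitivity (\sum_j X i j * (E *m w^T) j 0 * (E *m w^T) i 0); last first.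
  by rewrite -mulr_suml -mulmxA [in RHS]mxE.
apply: eq_bigr => j _.
rewrite [(E *m w^T) i 0]mxE mulr_sumr; apply: eq_bigr => k _.
rewrite [(E *m w^T) j 0]mxE !(mulr_sumr, mulr_suml); apply: eq_bigr => l _.
by rewrite ![_^T _ _]mxE -/E; ring.
Qed.

(** Completing the square: the mixed terms with G are traces, and |G|^2 is the
dimension. *)
Lemma normsqg_expand (G H K : 'M[R]_n) (k m : R) :
  G^T = G -> H^T = H -> K^T = K -> G \in unitmx ->
  let E := invmx G in
  normsqg G (H + k *: K - m *: G) =
  B E H H + k ^+ 2 * B E K K + m ^+ 2 * n%:R + 2 * k * B E K H
  - 2 * m * \tr (E *m H) - 2 * k * m * \tr (E *m K).
Proof.
move=> Gs Hsy Ks u0 E; have Es : E^T = E by rewrite /E trmx_inv Gs.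
have sy (Y : 'M[R]_n) a b : Y^T = Y -> Y b a = Y a b.
  by move=> Ys; rewrite -{1}Ys mxE.
have Xs : (H + k *: K - m *: G)^T = H + k *: K - m *: G.
  by apply/matrixP => a b; rewrite !mxE (sy H) // (sy K) // (sy G).
rewrite normsqgE // Xs -/E.
have EG : E *m G = 1%:M by rewrite mulVmx.
rewrite !(mulmxDl, mulmxDr, mulNmx, mulmxN) -!(scalemxAl, scalemxAr).
rewrite -!(mulmxA _ E G) EG !mulmx1 mul1mx.
rewrite !mxtraceD !mxtrace_opp !mxtraceZ.
have -> : B E H K = B E K H by rewrite -!(mulmxA (E *m _)) mxtrace_mulC.
by rewrite mxtrace1; ring.
Qed.

End Contractions.

(** * The Ricci flow in a coordinate domain *)
Section Bridge.

Context {R : realType} {n : nat} (Om : set 'rV[R]_n) (oOm : open Om) (T : R).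
Notation W := ('rV[R]_n * R)%type.
Notation I := (`[0, T[%classic : set R).
Notation A := (Om `*` I : set W).
Notation SF := (smooth_fun A).

Lemma extend_smooth (F : W -> R) (c : R) : smooth_on A F ->
  smooth_on A (fun z => if z \in A then F z else c).
Proof. by apply: smooth_on_eq => z Az; rewrite ifT // inE. Qed.

(** Off the domain the value is a constant; it is chosen so that the identities
of the ring hold there for trivial reasons: 0 for scalar functions, and the
entries of the identity matrix for the metric, which stays invertible. *)
Definition extend (F : W -> R) (c : R) (sF : smooth_on A F) : SF := mk_sf (extend_smooth c sF).

Lemma extend_in F c (sF : smooth_on A F) z : A z -> extend c sF z = F z.
Proof. by move=> Az; rewrite /extend /= ifT // inE. Qed.
Lemma extend_out F c (sF : smooth_on A F) z : ~ A z -> extend c sF z = c.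
Proof. by move=> Az; rewrite /extend /= ifF //; apply: memNset. Qed.

Definition cstS (c : R) : SF := mk_sf (@smooth_on_cst R _ A c).

Local Notation Dx := (fun i => Dspace oOm i : {additive SF -> SF}).
Local Notation Dt := (@Dtime R n Om T : {additive SF -> SF}).

Lemma Dspace_in i (F : SF) (f : 'rV[R]_n -> R) x t : A (x, t) ->
  (forall y, Om y -> F (y, t) = f y) -> Dx i F (x, t) = pd i f x.
Proof.
move=> Az e; rewrite /= /Dspace /= /dspace ifT ?inE // /pd /=.
apply: near_eq_derive.
by apply: filterS (open_nbhs_nbhs (conj oOm Az.1)) => y; exact: e.
Qed.

Lemma Dspace_out i (F : SF) z : ~ A z -> Dx i F z = 0.
Proof. exact: dspace_out. Qed.

Lemma Dtime_in (F : SF) x t l : A (x, t) ->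
  has_dt I (fun s => F (x, s)) t l -> Dt F (x, t) = l.
Proof. by move=> Az H; exact: (@dtime_has_dt R n Om T F (x, t) l Az H). Qed.

Lemma Dtime_out (F : SF) z : ~ A z -> Dt F z = 0.
Proof. exact: dtime_out. Qed.

Lemma Dtime_has_dt (F : SF) x t : A (x, t) ->
  has_dt I (fun s => F (x, s)) t (Dt F (x, t)).
Proof.
move=> Az; have [U [h [Uz r]]] := rep_ex F Az.
have := rep_has_dt r Uz Az.
by rewrite (rep_val ((@directional_Dtime R n Om T).1 _ _ _ r) Uz Az).
Qed.

Lemma Dspace_cst i c : Dx i (cstS c) = 0.
Proof.
apply: sf_eq => -[x t]; rewrite sf0; have [Az|Az] := pselect (A (x, t)); last exact: Dspace_out.
rewrite (@Dspace_in i _ (cst c)) //; exact: derive_cst.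
Qed.

Lemma Dtime_cst c : Dt (cstS c) = 0.
Proof.
apply: sf_eq => -[x t]; rewrite sf0; have [Az|Az] := pselect (A (x, t)); last exact: Dtime_out.
have H := derivable_has_dt I (derivable_cst c t (1 : R)).
by rewrite (@Dtime_in (cstS c) _ _ _ Az H) derive_cst.
Qed.

Lemma DxM i : leibniz (Dx i).
Proof.
move=> F G.
exact: (@directionalM _ _ _ _ (Dspace oOm i) F G (directional_Dspace oOm T i)).
Qed.

Lemma DxC i j F : Dx i (Dx j F) = Dx j (Dx i F).
Proof.
exact: (@directionalC _ _ _ _ _ (Dspace oOm i) (Dspace oOm j) F
  (directional_Dspace oOm T i) (directional_Dspace oOm T j)).
Qed.

Lemma DtM : leibniz Dt.
Proof.
move=> F G.
exact: (@directionalM _ _ _ _ (@Dtime R n Om T) F G (@directional_Dtime R n Om T)).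
Qed.

Lemma DtC i F : Dt (Dx i F) = Dx i (Dt F).
Proof.
exact: (@directionalC _ _ _ _ _ (@Dtime R n Om T) (Dspace oOm i) F
  (@directional_Dtime R n Om T) (directional_Dspace oOm T i)).
Qed.

Variable gm : R -> 'rV[R]_n -> 'M[R]_n.
Hypothesis gsm : forall i j, smooth_on A (fun z => gm z.2 z.1 i j).
Hypothesis gsy : forall x t, A (x, t) -> (gm t x)^T = gm t x.
Hypothesis gpos : forall x t, A (x, t) ->
  forall w : 'rV[R]_n, w != 0 -> 0 < (w *m gm t x *m w^T) 0 0.

Definition gS : 'M[SF]_n := \matrix_(i, j) extend (i == j)%:R (gsm i j).
Notation ev z := (map_mx (evz z)).

Lemma ev_gS x t : A (x, t) -> ev (x, t) gS = gm t x.
Proof. by move=> Az; apply/matrixP => i j; rewrite !mxE /evz extend_in. Qed.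

Lemma ev_gS_out z : ~ A z -> ev z gS = 1%:M.
Proof. by move=> Az; apply/matrixP => i j; rewrite !mxE /evz extend_out. Qed.

Lemma gS_sym : gS^T = gS.
Proof.
apply/matrixP => i j; rewrite !mxE; apply: sf_eq => -[x t].
have [Az|Az] := pselect (A (x, t)); last by rewrite !extend_out // eq_sym.
by rewrite !extend_in //= -[in LHS]gsy // mxE.
Qed.

Lemma ev_gS_unit z : ev z gS \in unitmx.
Proof.
have [Az|Az] := pselect (A z); last by rewrite ev_gS_out // unitmx1.
by case: z Az => x t Az; rewrite ev_gS //; apply: posdef_unit; exact: gpos.
Qed.

Lemma det_gS_neq0 z : A z -> (\det gS : SF) z != 0.
Proof.
by move=> _; have := ev_gS_unit z; rewrite unitmxE unitfE det_map_mx.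
Qed.

(** The inverse of the metric is built from the adjugate matrix, as its entries
have to be smooth. *)
Definition idet : SF := mk_sf (smooth_onV det_gS_neq0 (sfP (\det gS))).
Definition ES : 'M[SF]_n := idet *: \adj gS.

Lemma gS_ES : gS *m ES = 1%:M.
Proof.
rewrite /ES -scalemxAr mul_mx_adj scale_scalar_mx; congr (_%:M).
apply: sf_eq => z; rewrite sfM sf1 /= mulVf //.
by have := ev_gS_unit z; rewrite unitmxE unitfE det_map_mx.
Qed.

Lemma ev_ES x t : A (x, t) -> ev (x, t) ES = invmx (gm t x).
Proof.
move=> Az; have := congr1 (ev (x, t)) gS_ES; rewrite map_mxM map_mx1 ev_gS // => e.
have u : gm t x \in unitmx by have := ev_gS_unit (x, t); rewrite ev_gS.
by rewrite -[LHS]mul1mx -(mulVmx u) -mulmxA e mulmx1.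
Qed.

Definition halfS : SF := cstS 2^-1.
Lemma halfS2 : halfS + halfS = 1.
Proof. by apply: sf_eq => z; rewrite sfD sf1 [RHS]splitr mul1r. Qed.

Notation GammaS := (Gamma Dx gS ES halfS).
Notation curvS := (curv Dx gS ES halfS).
Notation RicciS := (Ricci Dx gS ES halfS).
Notation ScalS := (Scal Dx gS ES halfS).
Notation LapS := (Lap Dx gS ES halfS).
Notation HessS := (Hess Dx gS ES halfS).

Lemma sf_sum (J : Type) (r : seq J) (P : pred J) (F : J -> SF) z :
  (\sum_(j <- r | P j) F j) z = \sum_(j <- r | P j) F j z.
Proof. exact: (raddf_sum (evz z)). Qed.

Lemma ES_in x t i j : A (x, t) -> ES i j (x, t) = invmx (gm t x) i j.
Proof. by move=> Az; rewrite -ev_ES // [RHS]mxE. Qed.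

Lemma gS_in x t i j : A (x, t) -> gS i j (x, t) = gm t x i j.
Proof. by move=> Az; rewrite -ev_gS // [RHS]mxE. Qed.

Lemma GammaS_in x t i j k : A (x, t) -> GammaS i j k (x, t) = christoffel (gm t) k i j x.
Proof.
move=> Az; rewrite mxE sfM sf_sum /christoffel; congr (_ * _).
apply: eq_bigr => l _; rewrite sfM ES_in // sfD sfD sfN.
have e i' j' k' : Dx i' (gS j' k') (x, t) = pd i' (fun y => gm t y j' k') x.
  by apply: Dspace_in => // y Oy; rewrite gS_in //; split=> //; exact: Az.2.
by rewrite !e.
Qed.

(* Evaluation at a point is a ring morphism; the variables stand for the
Christoffel symbols and their derivatives. *)
Lemma eval_curv (G : 'I_n -> 'M[SF]_n) (X Y : SF) i j k l z :
  (X - Y + \sum_p (G j k p * G i p l - G i k p * G j p l)) z =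
  X z - Y z + \sum_p (G j k p z * G i p l z - G i k p z * G j p l z).
Proof. by rewrite !sfD sfN sf_sum. Qed.

Opaque Gamma.

Lemma curvS_in x t i j k l : A (x, t) -> curvS i j k l (x, t) = riemann (gm t) i j k l x.
Proof.
move=> Az; rewrite curv_entry (eval_curv GammaS) /riemann.
have e i' j' k' l' : Dx i' (GammaS j' k' l') (x, t) = pd i' (christoffel (gm t) l' j' k') x.
  by apply: Dspace_in => // y Oy; rewrite GammaS_in //; split=> //; exact: Az.2.
congr (_ - _ + _); [exact: e|exact: e|apply: eq_bigr => p _].
by congr (_ * _ - _ * _); exact: GammaS_in.
Qed.

Lemma RicciS_in x t : A (x, t) -> ev (x, t) RicciS = ricci (gm t) x.
Proof.
move=> Az; apply/matrixP => j k; rewrite !mxE /evz sf_sum.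
by apply: eq_bigr => i _; rewrite curvS_in.
Qed.

Lemma ES_trgE (X : 'M[SF]_n) x t : A (x, t) ->
  (gtrace ES X) (x, t) = trg (gm t x) (ev (x, t) X).
Proof.
move=> Az; rewrite (gtraceE gS_ES gS_sym) sf_sum; apply: eq_bigr => i _.
by rewrite sf_sum; apply: eq_bigr => j _; rewrite sfM ES_in // mxE.
Qed.

Lemma ScalS_in x t : A (x, t) -> ScalS (x, t) = scal (gm t) x.
Proof. by move=> Az; rewrite ES_trgE // RicciS_in. Qed.

Lemma gradv_in (F : SF) f x t : A (x, t) -> (forall y, Om y -> F (y, t) = f y) ->
  ev (x, t) (gradv Dx F) = (grad f x)^T.
Proof.
move=> Az e; apply/matrixP => i j; rewrite !mxE /evz; exact: Dspace_in.
Qed.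

Lemma HessS_in (F : SF) f x t : A (x, t) -> (forall y, Om y -> F (y, t) = f y) ->
  ev (x, t) (HessS F) = hess (gm t) f x.
Proof.
move=> Az e; apply/matrixP => i j; rewrite 2!mxE [RHS]mxE /evz /cov1.
rewrite addmxE oppmxE sfD sfN; congr (_ - _).
  rewrite !mxE; apply: Dspace_in => // y Oy; apply: Dspace_in => //.
  by split=> //; exact: Az.2.
rewrite mxE sf_sum; apply: eq_bigr => k _; rewrite sfM GammaS_in // [gradv _ _ _ _]mxE.
by rewrite (Dspace_in _ Az e).
Qed.

Lemma LapS_in (F : SF) f x t : A (x, t) -> (forall y, Om y -> F (y, t) = f y) ->
  LapS F (x, t) = laplacian (gm t) f x.
Proof. by move=> Az e; rewrite ES_trgE // (HessS_in Az e). Qed.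

Lemma ginner_in (F H : SF) f h x t : A (x, t) ->
  (forall y, Om y -> F (y, t) = f y) -> (forall y, Om y -> H (y, t) = h y) ->
  ginner ES (gradv Dx F) (gradv Dx H) (x, t) = dotg (gm t x) (grad f x) (grad h x).
Proof.
move=> Az e e'; rewrite ES_trgE // map_mxM -map_trmx (gradv_in Az e) (gradv_in Az e') trmxK.
apply: eq_bigr => i _; apply: eq_bigr => j _.
by rewrite mxE big_ord1 [(_^T) _ _]mxE mulrA.
Qed.

Lemma GammaS_out i j k z : ~ A z -> GammaS i j k z = 0.
Proof.
move=> Az; rewrite Gamma_entry sfM sf_sum big1 ?mulr0 // => l _.
by rewrite sfM sfD sfD sfN !Dspace_out // subr0 addr0 mulr0.
Qed.

Lemma curvS_out i j k l z : ~ A z -> curvS i j k l z = 0.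
Proof.
move=> Az; rewrite curv_entry (eval_curv GammaS).
have z1 (a b : R) : a = 0 -> b = 0 -> a - b = 0 by move=> -> ->; rewrite subr0.
have z2 (a b a' b' : R) : a = 0 -> a' = 0 -> a * b - a' * b' = 0.
  by move=> -> ->; rewrite !mul0r subr0.
rewrite big1 => [|p _]; first by rewrite addr0; apply: z1; exact: Dspace_out.
by apply: z2; exact: GammaS_out.
Qed.

Lemma RicciS_out j k z : ~ A z -> RicciS j k z = 0.
Proof.
move=> Az; rewrite [RicciS _ _]mxE sf_sum big1 // => i _; exact: curvS_out.
Qed.

Lemma HessS_out F i j z : ~ A z -> HessS F i j z = 0.
Proof.
move=> Az; rewrite Hess_entry sfD sfN Dspace_out // sub0r sf_sum big1 ?oppr0 // => k _.
by rewrite sfM (GammaS_out i j k Az) mul0r.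
Qed.

Lemma gtrace_out (X : 'M[SF]_n) z : (forall i j, X i j z = 0) -> gtrace ES X z = 0.
Proof.
move=> X0; rewrite (gtraceE gS_ES gS_sym) sf_sum big1 // => i _; rewrite sf_sum big1 // => j _.
by rewrite sfM X0 mulr0.
Qed.

Hypothesis hflow : forall x t, A (x, t) -> forall i j,
  has_dt I (fun s => gm s x i j) t (- 2 * ricci (gm t) x i j).

(** Holds off the domain as well: there the Christoffel symbols vanish with all
derivatives, hence so does the curvature. *)
Lemma Dt_gS : map_mx Dt gS = - (RicciS + RicciS).
Proof.
apply/matrixP => i j; rewrite [LHS]mxE oppmxE addmxE; apply: sf_eq => -[x t].
rewrite sfN sfD; have [Az|Az] := pselect (A (x, t)); last first.
  by rewrite Dtime_out // RicciS_out // addr0 oppr0.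
have H : has_dt I (fun s => gS i j (x, s)) t (- 2 * ricci (gm t) x i j).
  apply: (@has_dt_eq R I (fun s => gm s x i j) (fun s => gS i j (x, s))
    t _ _ _ (@hflow x t Az i j)).
    by rewrite gS_in.
  by near=> s => Is; rewrite gS_in //; split=> //; exact: Az.1.
rewrite (Dtime_in Az H) -(RicciS_in Az) [ev _ _ _ _]mxE /evz.
by rewrite mulNr mulrDl !mul1r.
Unshelve. all: by end_near. Qed.

Variable u : R -> 'rV[R]_n -> R.
Hypothesis usm : smooth_on A (fun z => u z.2 z.1).

Definition uS : SF := extend 0 usm.
Lemma uS_in x t : A (x, t) -> uS (x, t) = u t x.
Proof. exact: extend_in. Qed.

Lemma smooth_theta : smooth_on A (fun z : W => (T - z.2)^-1).
Proof.
apply: (@smooth_onV _ _ _ (fun z : W => T - z.2)).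
  by move=> z [_ /=]; rewrite in_itv /= subr_eq0 => /andP[_ zT]; rewrite gt_eqF.
apply: (@smooth_on_eq _ _ _ (cst T + cst (-1) * (fun z : W => z.2))).
  by move=> z _; rewrite /GRing.add /GRing.mul /= mulN1r.
apply: smooth_onD; first exact: smooth_on_cst.
apply: smooth_onM; first exact: smooth_on_cst.
move=> z Az; exists setT, (fun z : W => z.2); split=> //; first exact: openT.
by move=> k; apply: Ck_time; exact: openT.
Qed.

Definition thetaS : SF := extend 0 smooth_theta.
Lemma thetaS_in x t : A (x, t) -> thetaS (x, t) = (T - t)^-1.
Proof. exact: extend_in. Qed.

Lemma D_thetaS i : Dx i thetaS = 0.
Proof.
apply: sf_eq => -[x t]; rewrite sf0; have [Az|Az] := pselect (A (x, t)); last exact: Dspace_out.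
rewrite (@Dspace_in i _ (cst (T - t)^-1) _ _ Az); first exact: derive_cst.
by move=> y Oy; rewrite thetaS_in //; split=> //; exact: Az.2.
Qed.

Lemma Dt_thetaS : Dt thetaS = thetaS * thetaS.
Proof.
apply: sf_eq => -[x t]; rewrite sfM; have [Az|Az] := pselect (A (x, t)); last first.
  by rewrite Dtime_out // /thetaS extend_out // mul0r.
have Tt : T - t != 0.
  by case: Az => _ /=; rewrite in_itv /= subr_eq0 => /andP[_ tT]; rewrite gt_eqF.
have d1 : is_derive t (1 : R) (fun s : R => T - s) (0 - 1).
  exact: is_deriveB.
have d2 : derivable (fun s : R => T - s) t (1 : R) by case: d1.
have d3 : derivable (fun s : R => (T - s)^-1) t (1 : R).
  exact: (@derivableV _ _ (fun s : R => T - s) t 1 Tt d2).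
have H := derivable_has_dt I d3.
have H' : has_dt I (fun s => thetaS (x, s)) t ('D_1 (fun s : R => (T - s)^-1) t).
  apply: (@has_dt_eq R I (fun s => (T - s)^-1) (fun s => thetaS (x, s)) t _ _ _ H).
    by rewrite thetaS_in.
  by near=> s => Is; rewrite thetaS_in //; split=> //; exact: Az.1.
rewrite (Dtime_in Az H') (@deriveV _ _ (fun s : R => T - s) t 1 Tt d2).
rewrite (@derive_val _ _ _ _ _ _ _ d1) thetaS_in //.
by rewrite sub0r scalerN scaleNr opprK scaler1 ?mulr1 -expr2 exprVn.
Unshelve. all: by end_near. Qed.

Variable c : R.
Hypothesis huE : forall x t, A (x, t) ->
  has_dt I (fun s => u s x) t
   (- (laplacian (gm t) (u t) x - gradsq (gm t) (u t) x - c * scal (gm t) x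
       - n%:R / (2 * (T - t)))).

Local Notation wS := (ginner ES (gradv Dx uS) (gradv Dx uS)).

Lemma eval_heat (X Y c0 Z h0 n0 th : SF) z :
  (- (X - Y - c0 * Z - h0 * n0 * th)) z =
  - (X z - Y z - c0 z * Z z - h0 z * n0 z * th z).
Proof. by []. Qed.

Lemma Dt_uS : Dt uS = - (LapS uS - wS - cstS c * ScalS - halfS * cstS n%:R * thetaS).
Proof.
apply: sf_eq => -[x t]; rewrite eval_heat.
have [Az|Az] := pselect (A (x, t)); last first.
  have L0 : LapS uS (x, t) = 0 by apply: gtrace_out => i j; exact: HessS_out.
  have w0 : wS (x, t) = 0.
    apply: gtrace_out => i j; rewrite mxE sf_sum big1 // => k _.
    by rewrite sfM [gradv _ _ _ _]mxE Dspace_out // mul0r.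
  have S0 : ScalS (x, t) = 0 by apply: gtrace_out => i j; exact: RicciS_out.
  have th0 : thetaS (x, t) = 0 by exact: extend_out.
  rewrite Dtime_out //.
  have z0 (a b c0 d h0 m0 r : R) : a = 0 -> b = 0 -> d = 0 -> r = 0 ->
      0 = - (a - b - c0 * d - h0 * m0 * r).
    by move=> -> -> -> ->; rewrite !mulr0 !subr0 oppr0.
  exact: z0 L0 w0 S0 th0.
have H : has_dt I (fun s => uS (x, s)) t
   (- (laplacian (gm t) (u t) x - gradsq (gm t) (u t) x - c * scal (gm t) x
       - n%:R / (2 * (T - t)))).
  apply: (@has_dt_eq R I (fun s => u s x) (fun s => uS (x, s)) t _ _ _ (@huE x t Az)).
    by rewrite uS_in.
  by near=> s => Is; rewrite uS_in //; split=> //; exact: Az.1.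
rewrite (Dtime_in Az H).
have e y : Om y -> uS (y, t) = u t y.
  by move=> Oy; rewrite uS_in //; split=> //; exact: Az.2.
congr (- (_ - _ - _ * _ - _)); symmetry.
- exact: (LapS_in Az e).
- exact: (ginner_in Az e e).
- exact: (ScalS_in Az).
by rewrite thetaS_in //= invfM mulrA [2^-1 * _]mulrC.
Unshelve. all: by end_near. Qed.

Notation B E X Y := (\tr (E *m X *m E *m Y)).

Lemma ev_tr (X : 'M[SF]_n) z : (\tr X) z = \tr (ev z X).
Proof. by rewrite sf_sum; apply: eq_bigr => i _; rewrite mxE. Qed.

Lemma gnormsq_in (X : 'M[SF]_n) x t : A (x, t) ->
  gnormsq ES X (x, t) = B (invmx (gm t x)) (ev (x, t) X) (ev (x, t) X)^T.
Proof. by move=> Az; rewrite /gnormsq ev_tr !map_mxM ev_ES // map_trmx. Qed.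

Lemma gquad_in (F : SF) f x t : A (x, t) -> (forall y, Om y -> F (y, t) = f y) ->
  gquad ES RicciS (gradv Dx F) (x, t) =
  contrg (gm t x) (ricci (gm t) x) (grad f x) (grad f x).
Proof.
move=> Az e; rewrite contrgE sf_sum; apply: eq_bigr => k _; rewrite sfM.
by rewrite -RicciS_in // -(gradv_in Az e) -ev_ES // -!map_mxM ![ev _ _ _ _]mxE.
Qed.

Variables (al be a b d la : R).
Hypotheses (al0 : al != 0) (ab0 : 2 * al - 2 * be != 0).

(** P as an element of the ring; [P_coord] is its coordinate expression. *)
Definition P_smooth : SF := cstS al * LapS uS - cstS be * wS + cstS a * ScalS
  + cstS b * (uS * thetaS) + cstS d * (cstS n%:R * thetaS).

Definition P_coord (t : R) (y : 'rV[R]_n) : R :=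
  al * laplacian (gm t) (u t) y - be * gradsq (gm t) (u t) y + a * scal (gm t) y
  + b * (u t y / (T - t)) + d * (n%:R / (T - t)).

Lemma eval_P (C1 X1 C2 X2 C3 X3 C4 X4 X5 C5 X6 X7 : SF) z :
  (C1 * X1 - C2 * X2 + C3 * X3 + C4 * (X4 * X5) + C5 * (X6 * X7)) z =
  C1 z * X1 z - C2 z * X2 z + C3 z * X3 z + C4 z * (X4 z * X5 z)
  + C5 z * (X6 z * X7 z).
Proof. by []. Qed.

Lemma P_smooth_in x t : A (x, t) -> P_smooth (x, t) = P_coord t x.
Proof.
move=> Az; rewrite eval_P /P_coord.
have e y : Om y -> uS (y, t) = u t y.
  by move=> Oy; rewrite uS_in //; split=> //; exact: Az.2.
congr (_ * _ - _ * _ + _ * _ + _ * (_ * _) + _ * (_ * _)).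
- exact: (LapS_in Az e).
- exact: (ginner_in Az e e).
- exact: (ScalS_in Az).
- exact: (uS_in Az).
- exact: (thetaS_in Az).
- exact: (thetaS_in Az).
Qed.

Lemma eval_rhs (LP gPu nH cRc gScu LSc tRH nR w th S v : SF) z
    (LP' gPu' nH' cRc' gScu' LSc' tRH' nR' w' th' S' v' : R) :
  LP z = LP' -> gPu z = gPu' -> nH z = nH' -> cRc z = cRc' -> gScu z = gScu' ->
  LSc z = LSc' -> tRH z = tRH' -> nR z = nR' -> w z = w' -> th z = th' ->
  S z = S' -> v z = v' ->
  (- (LP - gPu *+ 2
    - (cstS al - cstS be) * nH *+ 2
    - (cstS al - cstS be *+ 2) * cRc *+ 2
    + (cstS a + cstS be * cstS c) * gScu *+ 2
    - (cstS al * cstS c + cstS a *+ 2) * LSc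
    - cstS al * tRH *+ 2
    - cstS a * nR *+ 2
    + cstS b * (w * th) - cstS b * cstS c * (S * th)
    - halfS * cstS b * cstS n%:R * (th * th) - cstS b * (v * (th * th))
    - cstS d * (cstS n%:R * (th * th)))) z =
  - (LP' - 2 * gPu' - 2 * (al - be) * nH' - 2 * (al - 2 * be) * cRc'
    + 2 * (a + be * c) * gScu' - (al * c + 2 * a) * LSc' - 2 * al * tRH'
    - 2 * a * nR' + b * (w' * th') - b * c * (S' * th')
    - 2^-1 * b * n%:R * (th' * th') - b * (v' * (th' * th'))
    - d * (n%:R * (th' * th'))).
Proof.
do 12 move=> <-.
transitivity (- (LP z - gPu z *+ 2 - (al - be) * nH z *+ 2
    - (al - be *+ 2) * cRc z *+ 2 + (a + be * c) * gScu z *+ 2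
    - (al * c + a *+ 2) * LSc z - al * tRH z *+ 2 - a * nR z *+ 2
    + b * (w z * th z) - b * c * (S z * th z)
    - 2^-1 * b * n%:R * (th z * th z) - b * (v z * (th z * th z))
    - d * (n%:R * (th z * th z)))); first by [].
ring.
Qed.

Lemma Dt_P_smooth : Dt P_smooth = - (LapS P_smooth
    - ginner ES (gradv Dx P_smooth) (gradv Dx uS) *+ 2
    - (cstS al - cstS be) * gnormsq ES (HessS uS) *+ 2
    - (cstS al - cstS be *+ 2) * gquad ES RicciS (gradv Dx uS) *+ 2
    + (cstS a + cstS be * cstS c) * ginner ES (gradv Dx ScalS) (gradv Dx uS) *+ 2
    - (cstS al * cstS c + cstS a *+ 2) * LapS ScalS
    - cstS al * \tr (ES *m RicciS *m ES *m HessS uS) *+ 2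
    - cstS a * gnormsq ES RicciS *+ 2
    + cstS b * (wS * thetaS) - cstS b * cstS c * (ScalS * thetaS)
    - halfS * cstS b * cstS n%:R * (thetaS * thetaS) - cstS b * (uS * (thetaS * thetaS))
    - cstS d * (cstS n%:R * (thetaS * thetaS))).
Proof.
have kc r : const Dx (cstS r) by move=> i; exact: Dspace_cst.
apply: (dt_evolution DxM DxC halfS2 gS_ES gS_sym DtM DtC Dt_gS) => //.
- exact: D_thetaS.
- exact: Dtime_cst.
- exact: Dtime_cst.
- exact: Dtime_cst.
- exact: Dtime_cst.
- exact: Dtime_cst.
- exact: Dtime_cst.
- exact: Dt_thetaS.
- exact: Dt_uS.
Qed.

(** Completing the square: B(Hess v, Hess v), B(Rc, Hess v) and B(Rc, Rc) are
[nH], [tRH] and [nR], and the traces of Hess v and Rc are [L] and [S].  The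
multiple of P cancels the terms linear in lambda. *)
Lemma rhs_algebra (N LP gPu nH cRc gScu LSc tRH nR w tau S v L : R) :
  tau != 0 ->
  - (LP - 2 * gPu - 2 * (al - be) * nH - 2 * (al - 2 * be) * cRc
    + 2 * (a + be * c) * gScu - (al * c + 2 * a) * LSc - 2 * al * tRH
    - 2 * a * nR + b * (w * tau^-1) - b * c * (S * tau^-1)
    - 2^-1 * b * N * (tau^-1 * tau^-1) - b * (v * (tau^-1 * tau^-1))
    - d * (N * (tau^-1 * tau^-1))) =
  - (LP - 2 * gPu
      - (2 * al - 2 * be) *
          (nH + (al / (2 * al - 2 * be)) ^+ 2 * nR + (la / (2 * tau)) ^+ 2 * N
           + 2 * (al / (2 * al - 2 * be)) * tRH - 2 * (la / (2 * tau)) * L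
           - 2 * (al / (2 * al - 2 * be)) * (la / (2 * tau)) * S)
      - (2 * al - 2 * be) / al * (la / tau) *
         (al * L - be * w + a * S + b * (v / tau) + d * (N / tau))
      - 2 * (al - 2 * be) * cRc
      + 2 * (a + be * c) * gScu
      + (2 * al - 2 * be) * (N * la ^+ 2 / (4 * tau ^+ 2))
      + (b - (2 * al - 2 * be) / al * la * be) * (w / tau)
      - (al * c + 2 * a) * LSc
      + (al ^+ 2 / (2 * al - 2 * be) - 2 * a) * nR
      + ((2 * al - 2 * be) / al * la - 1) * b * (v / tau ^+ 2)
      + ((2 * al - 2 * be) / al * la - 1) * d * (N / tau ^+ 2)
      - b * N / (2 * tau ^+ 2)
      + ((2 * al - 2 * be) / al * a * la - al * la - b * c) * (S / tau)).
Proof. by move=> t0; field; rewrite t0 al0 ab0. Qed.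

(** [Dt_P_smooth] evaluated at a point, where it is brought into the form with
the completed square. *)
Lemma local_evolution x t0 : A (x, t0) ->
  let tau := T - t0 in
  let G := gm t0 in
  let u0 := u t0 in
  let Rc := ricci G x in
  let gdot := dotg (G x) in
  has_dtau I (fun t => P_coord t x) t0
    ( laplacian G (P_coord t0) x - 2 * gdot (grad (P_coord t0) x) (grad u0 x)
      - (2 * al - 2 * be) *
          normsqg (G x) (hess G u0 x + (al / (2 * al - 2 * be)) *: Rc
                         - (la / (2 * tau)) *: G x)
      - (2 * al - 2 * be) / al * (la / tau) * P_coord t0 x
      - 2 * (al - 2 * be) * contrg (G x) Rc (grad u0 x) (grad u0 x)
      + 2 * (a + be * c) * gdot (grad (scal G) x) (grad u0 x)
      + (2 * al - 2 * be) * (n%:R * la ^+ 2 / (4 * tau ^+ 2))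
      + (b - (2 * al - 2 * be) / al * la * be)
          * (gradsq G u0 x / tau)
      - (al * c + 2 * a) * laplacian G (scal G) x
      + (al ^+ 2 / (2 * al - 2 * be) - 2 * a) * normsqg (G x) Rc
      + ((2 * al - 2 * be) / al * la - 1) * b * (u0 x / tau ^+ 2)
      + ((2 * al - 2 * be) / al * la - 1) * d * (n%:R / tau ^+ 2)
      - b * n%:R / (2 * tau ^+ 2)
      + ((2 * al - 2 * be) / al * a * la - al * la - b * c)
          * (scal G x / tau) ).
Proof.
move=> Az tau G u0 Rc gdot.
have It : I t0 by exact: Az.2.
have Ox : Om x by exact: Az.1.
have tau0 : tau != 0.
  by move: It; rewrite /= in_itv /= subr_eq0 => /andP[_ tT]; rewrite gt_eqF.
have eu y : Om y -> uS (y, t0) = u0 y by move=> Oy; exact: uS_in.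
have eS y : Om y -> ScalS (y, t0) = scal G y by move=> Oy; exact: ScalS_in.
have eP y : Om y -> P_smooth (y, t0) = P_coord t0 y by move=> Oy; exact: P_smooth_in.
set H := hess G u0 x; set E := invmx (G x).
have evH : ev (x, t0) (HessS uS) = H by exact: HessS_in Az eu.
have evR : ev (x, t0) RicciS = Rc by exact: RicciS_in.
have Gs : (G x)^T = G x by exact: gsy.
have Gu : G x \in unitmx by apply: posdef_unit; exact: gpos Az.
have Es : E^T = E by rewrite /E trmx_inv Gs.
have Hsy : H^T = H.
  rewrite -evH map_trmx; congr (ev _ _); apply: Hess_tr; last exact: gS_sym.
  exact: DxC.
have Rs : Rc^T = Rc.
  rewrite -evR map_trmx; congr (ev _ _).
  have X := (Ricci_tr halfS2 gS_sym Dt_gS). exact: X.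
have eN : Dt P_smooth (x, t0) = - (laplacian G (P_coord t0) x
    - 2 * gdot (grad (P_coord t0) x) (grad u0 x)
    - 2 * (al - be) * B E H H
    - 2 * (al - 2 * be) * contrg (G x) Rc (grad u0 x) (grad u0 x)
    + 2 * (a + be * c) * gdot (grad (scal G) x) (grad u0 x)
    - (al * c + 2 * a) * laplacian G (scal G) x - 2 * al * B E Rc H
    - 2 * a * B E Rc Rc + b * (gradsq G u0 x * tau^-1) - b * c * (scal G x * tau^-1)
    - 2^-1 * b * n%:R * (tau^-1 * tau^-1) - b * (u0 x * (tau^-1 * tau^-1))
    - d * (n%:R * (tau^-1 * tau^-1))).
  rewrite Dt_P_smooth; apply: eval_rhs.
  - exact: (LapS_in Az eP).
  - exact: (ginner_in Az eP eu).
  - by rewrite gnormsq_in // evH Hsy.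
  - exact: (gquad_in Az eu).
  - exact: (ginner_in Az eS eu).
  - exact: (LapS_in Az eS).
  - by rewrite ev_tr !map_mxM ev_ES // evH evR.
  - by rewrite gnormsq_in // evR Rs.
  - exact: (ginner_in Az eu eu).
  - exact: (thetaS_in Az).
  - exact: (ScalS_in Az).
  - exact: (uS_in Az).
rewrite /has_dtau (normsqg_expand _ _ Gs Hsy Rs Gu) (normsqgE _ Es) Rs.
rewrite -/E -(trgE H Es) -(trgE Rc Es) -/(laplacian G u0 x) -/(scal G x).
rewrite -rhs_algebra // -eN.
apply: (@has_dt_eq R I (fun s => P_smooth (x, s)) (fun s => P_coord s x)
  t0 _ _ _ (@Dtime_has_dt P_smooth x t0 Az)).
  exact: eP.
by near=> s => Is; apply: P_smooth_in.
Unshelve. all: by end_near. Qed.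

End Bridge.

(** * The evolution equation on the manifold *)
Theorem lemma3p4 (R : realType) (n : nat) (M : smooth_manifold R n) (T : R)
  (hT : 0 < T)
  (g : metric_family M `[0, T]%classic) (hg : ricci_flow g)
  (c alpha beta a b d lambda : R)
  (halpha : alpha != 0) (hab : 2 * alpha - 2 * beta != 0)
  (v : R -> M -> R) (hv : smooth_family `[0, T[%classic v)
  (hvE : forall phi (t : R) x, atlas phi -> `[0, T[%classic t -> cimg phi x ->
     let G := g phi t in let tau := T - t in
     has_dtau `[0, T[%classic (fun s => in_chart phi (v s) x) t
       (laplacian G (in_chart phi (v t)) x - gradsq G (in_chart phi (v t)) x
        - c * scal G x - n%:R / (2 * tau))) :
  forall phi (t0 : R) x, atlas phi -> `[0, T[%classic t0 -> cimg phi x ->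
  let P (t : R) (y : 'rV[R]_n) : R :=
    alpha * laplacian (g phi t) (in_chart phi (v t)) y
    - beta * gradsq (g phi t) (in_chart phi (v t)) y
    + a * scal (g phi t) y
    + b * (in_chart phi (v t) y / (T - t))
    + d * (n%:R / (T - t)) in
  let tau := T - t0 in
  let G := g phi t0 in
  let u := in_chart phi (v t0) in
  let Rc := ricci G x in
  let gdot := dotg (G x) in
  has_dtau `[0, T[%classic (fun t => P t x) t0
    ( laplacian G (P t0) x - 2 * gdot (grad (P t0) x) (grad u x)
      - (2 * alpha - 2 * beta) *
          normsqg (G x) (hess G u x + (alpha / (2 * alpha - 2 * beta)) *: Rc
                         - (lambda / (2 * tau)) *: G x)
      - (2 * alpha - 2 * beta) / alpha * (lambda / tau) * P t0 x
      - 2 * (alpha - 2 * beta) * contrg (G x) Rc (grad u x) (grad u x)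
      + 2 * (a + beta * c) * gdot (grad (scal G) x) (grad u x)
      + (2 * alpha - 2 * beta) * (n%:R * lambda ^+ 2 / (4 * tau ^+ 2))
      + (b - (2 * alpha - 2 * beta) / alpha * lambda * beta)
          * (gradsq G u x / tau)
      - (alpha * c + 2 * a) * laplacian G (scal G) x
      + (alpha ^+ 2 / (2 * alpha - 2 * beta) - 2 * a) * normsqg (G x) Rc
      + ((2 * alpha - 2 * beta) / alpha * lambda - 1) * b * (u x / tau ^+ 2)
      + ((2 * alpha - 2 * beta) / alpha * lambda - 1) * d * (n%:R / tau ^+ 2)
      - b * n%:R / (2 * tau ^+ 2)
      + ((2 * alpha - 2 * beta) / alpha * a * lambda - alpha * lambda - b * c)
          * (scal G x / tau) ).

Proof.
move=> phi t0 x aphi It Cx.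
have I' (t : R) : `[0, T[%classic t -> `[0, T]%classic t.
  by rewrite /= !in_itv /= => /andP[-> /ltW].
have gsm i j : smooth_on (cimg phi `*` `[0, T[%classic)
    (fun z : 'rV[R]_n * R => g phi z.2 z.1 i j).
  move=> z [Cz Iz]; have [U [h [oU Uz sh e]]] := mcomp_smooth g aphi i j (conj Cz (I' _ Iz)).
  by exists U, h; split=> // y [Cy Iy] Uy; apply: e => //; split=> //; exact: I'.
have gsy y t : (cimg phi `*` `[0, T[%classic) (y, t) -> (g phi t y)^T = g phi t y.
  by move=> [Cy /I' It']; exact: mcomp_sym.
have gpos y t : (cimg phi `*` `[0, T[%classic) (y, t) ->
    forall w : 'rV[R]_n, w != 0 -> 0 < (w *m g phi t y *m w^T) 0 0.
  by move=> [Cy /I' It']; exact: mcomp_pos.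
have hflow y t : (cimg phi `*` `[0, T[%classic) (y, t) -> forall i j,
    has_dt `[0, T[%classic (fun s => g phi s y i j) t (- 2 * ricci (g phi t) y i j).
  move=> [Cy Iy] i j; have H := @hg phi t y aphi (I' _ Iy) Cy i j.
  apply: cvg_trans H; apply: cvg_app.
  by apply: within_subset => s [/I'].
have huE y t (Az : (cimg phi `*` `[0, T[%classic) (y, t)) := @hvE phi t y aphi Az.2 Az.1.
have H := (@local_evolution R n (cimg phi) (@cimg_open R n M phi) T (g phi) gsm gsy gpos hflow
  (fun t => in_chart phi (v t)) (hv phi aphi) c huE alpha beta a b d lambda halpha hab x t0
  (conj Cx It)).
exact H.
Qed.
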